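(* Unless $\mathsf{NP} \subseteq \mathsf{coNP}/\mathsf{poly}$, the \textsc{Identifying Code} problem, parameterized by the vertex cover number of the input graph plus the solution size $k$, does not admit a polynomial kernel.
   Context: All graphs are finite and simple. For a graph $G=(V,E)$ and $v\in V$, $N[v]$ denotes the closed neighborhood of $v$ (i.e., $v$ together with its neighbors). An identifying code of $G$ is a set $I\subseteq V$ such that for every $v\in V$ the set $N[v]\cap I$ is nonempty, and for any two distinct vertices $u\neq v$ we have $N[u]\cap I\neq N[v]\cap I$. The \textsc{Identifying Code} problem: given a graph $G$ and an integer $k$, decide whether $G$ has an identifying code of size at most $k$. The vertex cover number of $G$ is the minimum size of a set $C\subseteq V$ such that every edge has an endpoint in $C$. For the parameter $p = \mathrm{vc}(G)+k$, a polynomial kernel is a polynomial-time algorithm that maps any instance to an equivalent instance of the same problem whose size (and new parameter) is bounded by a polynomial in $p$. *)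

(* Defs.v *)
From HB Require Import structures.
From mathcomp Require Import all_boot all_order all_algebra.

Set Implicit Arguments.
Unset Strict Implicit.
Unset Printing Implicit Defensive.

(** * Deterministic multi-tape Turing machines *)

Inductive move := MoveL | MoveR | Stay.

(* [None] is the blank, [Some (inl b)] an input/output bit, and [Some (inr s)]
   an auxiliary symbol of the machine. *)
Definition symbol (W : finType) : finType := option (bool + W)%type.

(* A tape that is infinite in both directions: the cells to the left of the
   head (nearest first), the scanned cell, and the cells to the right of the
   head (nearest first). All cells that are not listed are blank. *)
Record tape (W : finType) := Tape {
  tleft : seq (symbol W);
  tcur : symbol W;
  tright : seq (symbol W)
}.

Definition tmove (W : finType) (m : move) (t : tape W) : tape W :=
  match m with
  | MoveL => Tape (behead (tleft t)) (head None (tleft t)) (tcur t :: tright t)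
  | MoveR => Tape (tcur t :: tleft t) (head None (tright t)) (behead (tright t))
  | Stay => t
  end.

Definition twrite (W : finType) (a : symbol W) (t : tape W) : tape W :=
  Tape (tleft t) a (tright t).

Record machine := Machine {
  extra_tapes : nat;
  work : finType;
  state : finType;
  start : state;
  halting : pred state;
  trans : state -> {ffun 'I_extra_tapes.+1 -> symbol work} ->
          state * ('I_extra_tapes.+1 -> symbol work * move)
}.

Definition config (M : machine) : Type :=
  (state M * {ffun 'I_(extra_tapes M).+1 -> tape (work M)})%type.

(* Halting configurations are fixed points. *)
Definition step (M : machine) (c : config M) : config M :=
  if halting c.1 then c else
  let r := trans c.1 [ffun i => tcur (c.2 i)] in
  (r.1, [ffun i => tmove (r.2 i).2 (twrite (r.2 i).1 (c.2 i))]).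

Definition tape_of_bits (W : finType) (x : seq bool) : tape W :=
  let s : seq (symbol W) := [seq Some (inl b) | b <- x] in
  Tape [::] (head None s) (behead s).

Definition init (M : machine) (x : seq bool) : config M :=
  (start M, [ffun i => tape_of_bits (work M) (if i == ord0 then x else [::])]).

Fixpoint leading_bits (W : finType) (s : seq (symbol W)) : seq bool :=
  if s is Some (inl b) :: s' then b :: leading_bits s' else [::].

(* The output is the maximal block of bits that starts at the head of the
   first tape. *)
Definition output (M : machine) (c : config M) : seq bool :=
  let t := c.2 ord0 in leading_bits (tcur t :: tright t).

Definition outputs_within (M : machine) (x y : seq bool) (t : nat) : Prop :=
  let c := iter t (@step M) (init M x) in halting c.1 /\ output c = y.

(** * Polynomial time, NP, and coNP/poly *)

Definition polytime (A B : Type) (encA : A -> seq bool) (encB : B -> seq bool)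
    (f : A -> B) : Prop :=
  exists (M : machine) (p : {poly nat}), forall a : A,
    outputs_within M (encA a) (encB (f a)) (p.[size (encA a)])%R.

Definition enc_bool (b : bool) : seq bool := [:: b].

(* <x, y> is encoded as 1 x_1 1 x_2 ... 1 x_n 0 y. *)
Definition enc_pair (xy : seq bool * seq bool) : seq bool :=
  flatten [seq [:: true; b] | b <- xy.1] ++ false :: xy.2.

Definition language := seq bool -> Prop.

Definition NP (L : language) : Prop :=
  exists (V : seq bool * seq bool -> bool) (p : {poly nat}),
    polytime enc_pair enc_bool V /\
    forall x, L x <-> exists w, size w <= (p.[size x])%R /\ V (x, w).

Definition coNP (L : language) : Prop := NP (fun x => ~ L x).

(* Languages decided in the class [C] with polynomially long advice that
   depends only on the length of the input. *)
Definition with_poly_advice (C : language -> Prop) (L : language) : Prop :=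
  exists (L' : language) (advice : nat -> seq bool) (p : {poly nat}),
    [/\ C L',
        forall n, size (advice n) <= (p.[n])%R
      & forall x, L x <-> L' (enc_pair (x, advice (size x)))].

Definition NP_subset_coNP_poly : Prop :=
  forall L : language, NP L -> with_poly_advice coNP L.

(** * Polynomial kernels *)

(* The parameter [kappa] need not be computable in polynomial time, and it is
   not part of the input of the kernelization algorithm. *)
Definition poly_kernel (A : Type) (enc : A -> seq bool) (Q : A -> Prop)
    (kappa : A -> nat) : Prop :=
  exists K : A -> A,
    [/\ polytime enc enc K,
        forall a, Q a <-> Q (K a)
      & exists p : {poly nat}, forall a,
          size (enc (K a)) <= (p.[kappa a])%R /\
          kappa (K a) <= (p.[kappa a])%R].

(** * Graphs and identifying codes *)

Record graph := Graph {
  nverts : nat;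
  adj : rel 'I_nverts;
  adj_sym : symmetric adj;
  adj_irr : irreflexive adj
}.

Definition closed_nbhd (G : graph) (v : 'I_(nverts G)) : {set 'I_(nverts G)} :=
  [set u | (u == v) || adj v u].

Definition identifying_code (G : graph) (I : {set 'I_(nverts G)}) : Prop :=
  (forall v, closed_nbhd v :&: I != set0) /\
  (forall u v, u != v -> closed_nbhd u :&: I != closed_nbhd v :&: I).

Definition vertex_cover (G : graph) (C : {set 'I_(nverts G)}) : bool :=
  [forall u, forall v, adj u v ==> (u \in C) || (v \in C)].

Definition vc (G : graph) : nat :=
  #|[arg min_(C < [set: 'I_(nverts G)] | vertex_cover C) #|C|]|.

Definition instance : Type := (graph * nat)%type.

Definition IdentifyingCode (a : instance) : Prop :=
  exists I : {set 'I_(nverts a.1)}, identifying_code I /\ #|I| <= a.2.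

Definition vc_plus_k (a : instance) : nat := vc a.1 + a.2.

(* 1^n 0 followed by the n x n adjacency matrix, row by row. *)
Definition enc_graph (G : graph) : seq bool :=
  nseq (nverts G) true ++ false ::
  [seq adj u v | u <- enum 'I_(nverts G), v <- enum 'I_(nverts G)].

(* The solution size k is written in unary, after the (self-delimiting) code of
   the graph. *)
Definition enc_instance (a : instance) : seq bool :=
  enc_graph a.1 ++ nseq a.2 true.

(* Main.v *)
(** Suppose that a polynomial kernel [K] exists and let [L] be in NP.  By the
    tableau construction, the inputs of length [n] in [L] are described by a
    formula of polynomial size; since advice is allowed, these formulas need not
    be computable.

    A list of [t = 2 ^ l] strings of length [n] is composed into one instance
    that is a yes-instance iff some string of the list is in [L], and whose
    parameter is polynomial in [n] and linear in [l].  The step in between is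
    a hitting set instance over the literals of the formula and of [l] selector
    variables; each set becomes a pair of vertices that the code can only tell
    apart inside the set, all other pairs being told apart by forced vertices.

    Hence [K] maps the [t]-tuples of no-instances to strings shorter than [t].
    As in the Fortnow-Santhanam argument, some string is the image of tuples that
    contain half of the no-instances, so [n + 1] strings cover all of them.
    These strings are the advice: [x] is not in [L] iff a tuple that contains
    [x] is mapped to one of them.  The latter is again a formula of polynomial
    size, so the only machine to be built evaluates formulas. *)

Require Import Defs.
From mathcomp Require Import all_boot all_order all_algebra.
From mathcomp Require Import boolp zify.

Set Implicit Arguments.
Unset Strict Implicit.
Unset Printing Implicit Defensive.

(** * Polynomially bounded functions *)

(** Horner's scheme turns claims about polynomial values into inductions on functions. *)
Lemma horner_nat_ind (P : (nat -> nat) -> Prop) :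
  (forall f g, f =1 g -> P f -> P g) ->
  P (fun=> 0) ->
  (forall f c, P f -> P (fun n => f n * n + c)) ->
  forall p : {poly nat}, P (horner p).
Proof.
move=> Pext P0 PS; elim/poly_ind => [|p c IHp].
  by apply: Pext P0 => n; rewrite horner0.
by apply: Pext (PS _ c IHp) => n; rewrite hornerMXaddC.
Qed.

Lemma leq_horner_nat (p : {poly nat}) m n : m <= n -> (p.[m])%R <= (p.[n])%R.
Proof.
move=> le_mn; apply: (@horner_nat_ind (fun f => f m <= f n)) => [f g efg|//|f c le_f].
  by rewrite -!efg.
by rewrite leq_add2r leq_mul.
Qed.

Definition pbounded (f : nat -> nat) : Prop :=
  exists p : {poly nat}, forall n, f n <= (p.[n])%R.

Lemma pboundedW f g : (forall n, f n <= g n) -> pbounded g -> pbounded f.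
Proof. by move=> fg [p gp]; exists p => n; apply: leq_trans (gp n). Qed.

Lemma pbounded_cst c : pbounded (fun=> c).
Proof. by exists (c%:P)%R => n; rewrite hornerC. Qed.

Lemma pbounded_id : pbounded id.
Proof. by exists ('X)%R => n; rewrite hornerX. Qed.

Lemma pboundedD f g : pbounded f -> pbounded g -> pbounded (fun n => f n + g n).
Proof.
by move=> [p fp] [q gq]; exists (p + q)%R => n; rewrite hornerD leq_add.
Qed.

Lemma pboundedS f : pbounded f -> pbounded (fun n => (f n).+1).
Proof.
move=> pf; apply: pboundedW (pboundedD pf (pbounded_cst 1)) => n.
by rewrite addn1.
Qed.

Lemma pboundedM f g : pbounded f -> pbounded g -> pbounded (fun n => f n * g n).
Proof.
by move=> [p fp] [q gq]; exists (p * q)%R => n; rewrite hornerM leq_mul.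
Qed.

Lemma pbounded_horner (p : {poly nat}) f :
  pbounded f -> pbounded (fun n => (p.[f n])%R).
Proof.
move=> pf; apply: (@horner_nat_ind (fun g => pbounded (g \o f))) => [g h egh pg||g c pg].
- by apply: pboundedW pg => n /=; rewrite egh.
- exact: pbounded_cst.
- by apply: pboundedD (pbounded_cst c); apply: pboundedM.
Qed.

(** From [n + 1 <= (d + 1) * 2 ^ (n %/ (d + 1))], raised to the power [d + 1]. *)
Lemma expn_leq_exp2 d n : n.+1 ^ d.+1 <= d.+1 ^ d.+1 * 2 ^ n.
Proof.
have h : n.+1 <= d.+1 * 2 ^ (n %/ d.+1).
  apply: leq_trans (_ : d.+1 * (n %/ d.+1).+1 <= _).
    by rewrite mulnC ltn_ceil.
  by rewrite leq_mul2l ltn_expl ?orbT.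
have := h; rewrite -(leq_exp2r _ _ (ltn0Sn d)) => /leq_trans -> //.
by rewrite expnMn leq_mul2l -expnM leq_exp2l // leq_trunc_div orbT.
Qed.

Lemma horner_leq_expn (p : {poly nat}) :
  exists d c, forall n, (p.[n])%R <= c * n.+1 ^ d.
Proof.
apply: (@horner_nat_ind (fun f => exists d c, forall n, f n <= c * n.+1 ^ d))
  => [f g efg [d [c h]]||f b [d [c h]]].
- by exists d, c => n; rewrite -efg.
- by exists 0, 0.
exists d.+1, (c + b) => n.
have := h n; have : 0 < n.+1 ^ d by rewrite expn_gt0.
rewrite expnS; nia.
Qed.

Lemma horner_leq_exp2 (p : {poly nat}) :
  exists a, forall n, a <= n -> (p.[n])%R <= 2 ^ n.
Proof.
have [d [c h]] := horner_leq_expn p.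
(* The exponent [d.+1] exceeds the degree bound [d] by one; the spare factor [n.+1] absorbs the
   constants once [n] reaches this threshold. *)
exists (c * d.+1 ^ d.+1) => n le_an.
have {h} := h n; have := expn_leq_exp2 d n.
rewrite (expnS n.+1); move: (n.+1 ^ d) (2 ^ n) => u v h1 h2.
apply: leq_trans h2 _; rewrite -(@leq_pmul2l n.+1) //.
have := leq_mul (leqnn c) h1; nia.
Qed.

(** * Formulas and circuits *)

Definition cnf (X : Type) : Type := seq (seq (X * bool)).

Definition sat_clause (X : Type) (a : X -> bool) (c : seq (X * bool)) : bool :=
  has (fun l => a l.1 == l.2) c.

Definition sat (X : Type) (a : X -> bool) (f : cnf X) : bool :=
  all (sat_clause a) f.

Lemma sat_cat X (a : X -> bool) f g : sat a (f ++ g) = sat a f && sat a g.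
Proof. exact: all_cat. Qed.

Definition map_cnf (X Y : Type) (h : X -> Y) (f : cnf X) : cnf Y :=
  [seq [seq (h l.1, l.2) | l <- c] | c <- f].

Lemma map_cnf_nonempty (X Y : eqType) (h : X -> Y) (f : cnf X) :
  [::] \notin f -> [::] \notin map_cnf h f.
Proof. by move=> ne_f; apply/negP => /mapP[[|//] cf _]; case/negP: ne_f. Qed.

Lemma sat_map X Y (h : X -> Y) (a : Y -> bool) (f : cnf X) :
  sat a (map_cnf h f) = sat (a \o h) f.
Proof. by rewrite /sat all_map; apply: eq_all => c /=; rewrite /sat_clause has_map. Qed.

Lemma eq_sat X (a b : X -> bool) (f : cnf X) : a =1 b -> sat a f = sat b f.
Proof. by move=> eab; apply: eq_all => c; apply: eq_has => l; rewrite eab. Qed.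

Lemma sat_clause_zip_negb X (a : X -> bool) (s : seq X) (e : seq bool) :
  size s <= size e ->
  sat_clause a (zip s (map negb e)) = ([seq a x | x <- s] != take (size s) e).
Proof.
elim: s e => [|x s IHs] [|b e] //= le_se.
rewrite /sat_clause /= -/(sat_clause _ _) IHs // eqseq_cons.
by case: (a x); case: b.
Qed.

(** * Clauses that determine the gates of a circuit *)

Section Circuit.

Variables (I : Type) (X : finType) (val : I -> X -> bool).
Variables (gate : pred X) (deps : X -> seq X) (rk : X -> nat) (r : nat).
Hypothesis rk_deps : forall x y, gate x -> y \in deps x -> rk y < rk x.
Hypothesis size_deps : forall x, size (deps x) <= r.
Hypothesis val_local :
  forall x i j, gate x -> {in deps x, val i =1 val j} -> val i x = val j x.

(** The truth table of a gate is given semantically. Patterns have the fixed length [r], so only a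
    prefix of them matters. A pattern that never occurs forces both values, which is harmless as no
    [val i] exhibits it. *)
Definition forces (t : X * r.-tuple bool * bool) : Prop :=
  gate t.1.1 /\
  forall i, map (val i) (deps t.1.1) = take (size (deps t.1.1)) t.1.2 ->
            val i t.1.1 = t.2.

Definition gate_clause (t : X * r.-tuple bool * bool) : seq (X * bool) :=
  (t.1.1, t.2) :: zip (deps t.1.1) (map negb t.1.2).

Definition circuit_cnf : cnf X :=
  [seq gate_clause t
  | t <- enum {: X * r.-tuple bool * bool} & `[< forces t >]].

Lemma size_circuit_cnf : size circuit_cnf <= #|X| * 2 ^ r * 2.
Proof.
rewrite size_map size_filter (leq_trans (count_size _ _)) // -cardT.
by rewrite !card_prod card_tuple card_bool.
Qed.

Lemma circuit_cnf_nonempty : [::] \notin circuit_cnf.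
Proof. by apply/negP => /mapP[]. Qed.

Lemma circuit_cnf_val i : sat (val i) circuit_cnf.
Proof.
apply/allP => c /mapP[t]; rewrite mem_filter => /andP[/asboolP[_ ft] _] ->.
rewrite /sat_clause /= -/(sat_clause _ _) sat_clause_zip_negb ?size_tuple //.
by rewrite orbC; case: eqP => /= [e|//]; rewrite (ft i e).
Qed.

(** Induction on the rank: once [a] agrees with [val i] on the dependencies of a gate, locality
    makes their pattern force the value of the gate. *)
Lemma circuit_cnf_unique a i :
  sat a circuit_cnf -> (forall x, ~~ gate x -> a x = val i x) -> a =1 val i.
Proof.
move=> sat_a a_inp x; have [m] := ubnP (rk x); elim: m x => // m IHm x lt_xm.
have [gx|/a_inp //] := boolP (gate x).
have a_deps : {in deps x, a =1 val i}.
  move=> y dy; apply: IHm; apply: leq_trans (rk_deps gx dy) _.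
  by rewrite -ltnS.
set e : seq bool := map (val i) (deps x) ++ nseq (r - size (deps x)) true.
have size_e : size e == r.
  by rewrite /e size_cat size_map size_nseq subnKC.
have take_e : take (size (deps x)) e = map (val i) (deps x).
  by rewrite /e take_size_cat ?size_map.
pose t := (x, Tuple size_e, val i x).
have tc : t \in [seq t <- enum {: X * r.-tuple bool * bool} | `[< forces t >]].
  rewrite mem_filter mem_enum andbT; apply/asboolP; split=> //= j.
  by rewrite take_e => /eq_in_map; apply: val_local.
move/allP/(_ _ (map_f gate_clause tc)): sat_a.
rewrite /sat_clause /= -/(sat_clause _ _) sat_clause_zip_negb ?(eqP size_e) //.
rewrite take_e; have /eq_in_map -> := a_deps.
by rewrite eqxx orbF => /eqP.
Qed.

End Circuit.

(** * The tableau of a machine *)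

Section TapeCells.

Variable W : finType.

(* Cells are addressed relative to the head: [None] is the scanned cell,
   [Some (true, p)] and [Some (false, p)] the [p]-th cell to its right and to
   its left, counted from 0. *)
Definition cell (t : tape W) (o : option (bool * nat)) : symbol W :=
  match o with
  | None => tcur t
  | Some (true, p) => nth None (tright t) p
  | Some (false, p) => nth None (tleft t) p
  end.

(** The address, before the move, of the cell that has address [o] after it; the answer [None]
    designates the cell that was just written. *)
Definition source (m : move) (o : option (bool * nat)) : option (bool * nat) :=
  match m, o with
  | Stay, _ => o
  | MoveR, None => Some (true, 0)
  | MoveR, Some (true, p) => Some (true, p.+1)
  | MoveR, Some (false, p) => if p is p'.+1 then Some (false, p') else None
  | MoveL, None => Some (false, 0)
  | MoveL, Some (false, p) => Some (false, p.+1)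
  | MoveL, Some (true, p) => if p is p'.+1 then Some (true, p') else None
  end.

Lemma cell_tmove m a t o :
  cell (tmove m (twrite a t)) o
  = if source m o is Some o' then cell t (Some o') else a.
Proof.
by case: m o => [] [[[] [|p]]|] //=; rewrite ?nth_behead ?nth0.
Qed.

Lemma cell_tape_of_bits x o :
  cell (tape_of_bits W x) o =
  match o with
  | None => omap inl (onth x 0)
  | Some (true, p) => omap inl (onth x p.+1)
  | Some (false, _) => None
  end.
Proof.
have nthE p : nth None [seq Some (inl b) | b <- x] p = omap inl (onth x p)
    :> symbol W.
  by elim: x p => [|b x IHx] [|p] //=; rewrite ?nth_nil.
by case: o => [[[] p]|] /=; rewrite ?nth_nil // ?nth_behead -?nth0 nthE.
Qed.

End TapeCells.

(** * Locality of a machine step *)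

Section Locality.

Variables (M : machine) (R : nat).

Local Notation Pos := (option (bool * 'I_R.+1)).
Local Notation tapes := 'I_(extra_tapes M).+1.

(** One-hot bits for the state and for the symbols in a window around each head. As addresses are
    relative to the heads, head positions need no variables. *)
Definition cbit : finType := (state M + tapes * Pos * symbol (work M))%type.

Definition natpos (o : Pos) : option (bool * nat) :=
  if o is Some (b, p) then Some (b, val p) else None.

Definition ordpos (o : option (bool * nat)) : Pos :=
  if o is Some (b, p) then Some (b, inord p) else None.

Definition bit (c : config M) (b : cbit) : bool :=
  match b with
  | inl q => c.1 == q
  | inr (i, o, s) => cell (c.2 i) (natpos o) == s
  end.

Definition cell_bits (io : tapes * Pos) : seq cbit :=
  [seq inr (io, s) | s <- enum {: symbol (work M)}].

Definition head_bits : seq cbit :=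
  [seq inl q | q <- enum {: state M}] ++
  [seq inr (i, None, s) | i <- enum {: tapes}, s <- enum {: symbol (work M)}].

Definition step_deps (b : cbit) : seq cbit :=
  head_bits ++
  if b is inr (i, o, _) then
    let near m := cell_bits (i, ordpos (source m (natpos o))) in
    near MoveL ++ near MoveR ++ near Stay
  else [::].

Definition deps_bound : nat :=
  #|state M| + #|tapes| * #|symbol (work M)| + 3 * #|symbol (work M)|.

Lemma size_step_deps b : size (step_deps b) <= deps_bound.
Proof.
rewrite /step_deps /head_bits /deps_bound !size_cat size_map size_allpairs.
rewrite -!cardT leq_add2l; case: b => [//|[[i o] s]].
have sizeC io : size (cell_bits io) = #|symbol (work M)|.
  by rewrite size_map -cardT.
by rewrite !size_cat !sizeC; lia.
Qed.

Definition fits (c : config M) : Prop :=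
  forall i, size (tleft (c.2 i)) <= R /\ size (tright (c.2 i)) <= R.

Lemma cell_fits c i b p : fits c -> R <= p -> cell (c.2 i) (Some (b, p)) = None.
Proof.
move=> /(_ i)[fl fr] le_Rp.
by case: b => /=; rewrite nth_default // (leq_trans _ le_Rp).
Qed.

(** The dependencies include the state and all scanned symbols, so both configurations make the same
    transition. After it, a cell is freshly written or comes from one of the three possible sources,
    which are included too. *)
Lemma step_local c c' b :
    fits c -> fits c' -> {in step_deps b, bit c =1 bit c'} ->
  bit (step c) b = bit (step c') b.
Proof.
move=> fc fc' eqb.
(* An indicator bit that holds in [c] also holds in [c']; this transfers states and symbols, not
   just single bits. *)
have eqs : c'.1 = c.1.
  apply/eqP; rewrite -[_ == _]/(bit c' (inl c.1)) -eqb /= ?eqxx //.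
  by rewrite !mem_cat map_f ?mem_enum.
have eqh : [ffun i => tcur (c'.2 i)] = [ffun i => tcur (c.2 i)].
  apply/ffunP => i; rewrite !ffunE; apply/eqP.
  rewrite -[_ == _]/(bit c' (inr (i, None, tcur (c.2 i)))) -eqb /= ?eqxx //.
  by rewrite !mem_cat (@allpairs_f _ _ _ (fun i s => inr (i, None, s)))
             ?mem_enum ?orbT.
case: b eqb => [q|[[i o] s]] eqb.
  by rewrite /= /step eqs eqh; case: ifP => _ //=; rewrite eqs.
have eqc m : cell (c'.2 i) (source m (natpos o))
             = cell (c.2 i) (source m (natpos o)).
  have : {in cell_bits (i, ordpos (source m (natpos o))), bit c =1 bit c'}.
    move=> b b_in; apply: eqb; rewrite mem_cat; apply/orP; right.
    by rewrite !mem_cat; case: m b_in => ->; rewrite ?orbT.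
  case: (source m _) => [[d p]|] eqb'; last first.
    apply/eqP; rewrite -[_ == _]/(bit c' (inr (i, None, tcur (c.2 i)))).
    by rewrite -eqb' /= ?eqxx // map_f ?mem_enum.
  (* [ordpos] garbles a source outside the window, but there both tapes are blank. *)
  have [lt_pR|le_Rp] := ltnP p R.+1; last first.
    by rewrite !(cell_fits i d) // ltnW.
  have := eqb' (inr (i, Some (d, inord p), cell (c.2 i) (Some (d, p)))).
  rewrite map_f ?mem_enum // => /(_ isT).
  by rewrite /bit /natpos [val _]inordK // eqxx => /esym/eqP.
rewrite /= /step eqs eqh; case: ifP => _ /=; first by rewrite (eqc Stay).
rewrite !ffunE !cell_tmove.
set m := (X in source X _); have := eqc m.
by case: (source m _) => [o'|//] /= ->.
Qed.

End Locality.

Lemma fitsW M R R' (c : config M) : R <= R' -> fits R c -> fits R' c.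
Proof. by move=> le_R fc i; have [h1 h2] := fc i; split; apply: leq_trans le_R. Qed.

Lemma fits_init M x : fits (size x) (init M x).
Proof.
move=> i; rewrite /= ffunE /=; split=> //.
by rewrite size_behead size_map; case: ifP => _ //; apply: leq_pred.
Qed.

Lemma fits_step M R (c : config M) : fits R c -> fits R.+1 (step c).
Proof.
move=> fc; rewrite /step; case: ifP => _; first exact: fitsW fc.
move=> i; rewrite /= ffunE; have [hl hr] := fc i.
set m := (X in tmove X _).
case: m => /=; rewrite ?size_behead; 
  by move: (size _) (size _) hl hr => a b *; lia.
Qed.

Lemma fits_iter M x n : fits (size x + n) (iter n (@step M) (init M x)).
Proof.
elim: n => [|n IHn]; first by rewrite addn0; apply: fits_init.
by rewrite addnS; apply: fits_step.
Qed.

(** * The tableau of a family of runs *)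

Section Tableau.

Variables (M : machine) (I : Type) (str : I -> seq bool) (m T : nat).
Variables (Y : finType) (ival : I -> Y -> bool) (src : nat -> seq Y) (r : nat).
Hypothesis size_str : forall i, size (str i) <= m.
Hypothesis size_src : forall p, size (src p) <= r.
Hypothesis str_local : forall p i j,
  {in src p, ival i =1 ival j} -> onth (str i) p = onth (str j) p.

Definition tvar : finType := (Y + 'I_T.+1 * cbit M (m + T))%type.

Definition run (n : nat) (i : I) : config M := iter n (@step M) (init M (str i)).

Definition tabval (i : I) (v : tvar) : bool :=
  match v with
  | inl y => ival i y
  | inr (n, b) => bit (run n i) b
  end.

(** The value 0 is the right one for scanned cells; it is harmless for states and for cells to the
    left, whose initial contents do not depend on the input. *)
Definition input_pos (b : cbit M (m + T)) : nat :=
  if b is inr (_, Some (true, p), _) then (val p).+1 else 0.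

Definition tdeps (v : tvar) : seq tvar :=
  match v with
  | inl _ => [::]
  | inr (n, b) =>
      if val n is n'.+1 then [seq inr (inord n', b') | b' <- step_deps b]
      else [seq inl y | y <- src (input_pos b)]
  end.

Definition trank (v : tvar) : nat := if v is inr (n, _) then n.+1 else 0.

Definition tgate (v : tvar) : bool := if v is inr _ then true else false.

Lemma trank_deps v w : tgate v -> w \in tdeps v -> trank w < trank v.
Proof.
case: v => [//|[n b]] _ /=; case: (val n) (ltn_ord n) => [|n'] lt_n.
  by case/mapP=> y _ ->.
by case/mapP=> b' _ -> /=; rewrite inordK // ltnW.
Qed.

Lemma size_tdeps v : size (tdeps v) <= r + deps_bound M.
Proof.
case: v => [//|[n b]] /=; case: (val n) => [|n']; rewrite size_map.
  by apply: leq_trans (size_src _) _; apply: leq_addr.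
by apply: leq_trans (size_step_deps _) _; apply: leq_addl.
Qed.

Lemma fits_run n i : n <= T -> fits (m + T) (run n i).
Proof.
by move=> le_nT; apply: fitsW (@fits_iter M (str i) n); rewrite leq_add.
Qed.

Lemma init_local b i j :
  {in src (input_pos b), ival i =1 ival j} -> bit (run 0 i) b = bit (run 0 j) b.
Proof.
case: b => [q //|[[k o] s]] /= eqi; rewrite !ffunE !cell_tape_of_bits.
case: (k == ord0) => //; case: o eqi => [[[] p]|] // /str_local;
  by rewrite /natpos => ->.
Qed.

Lemma tabval_local v i j :
  tgate v -> {in tdeps v, tabval i =1 tabval j} -> tabval i v = tabval j v.
Proof.
case: v => [//|[[n ltn] b]] _ /=; case: n ltn => [|n] lt_n eqv.
  by apply: init_local => y ys; apply: (eqv (inl y)); apply: map_f.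
apply: step_local; [exact/fits_run/ltnW|exact/fits_run/ltnW|move=> b' b'_in].
have := eqv (inr (inord n, b')); rewrite /= map_f // => /(_ isT).
by rewrite inordK // ltnW.
Qed.

Lemma card_tvar :
  #|tvar| = #|Y| + T.+1 * (#|state M| + (extra_tapes M).+1 *
              (2 * (m + T).+1).+1 * #|symbol (work M)|).
Proof.
by rewrite card_sum card_prod card_sum !card_prod card_option card_prod
           card_bool !card_ord.
Qed.

End Tableau.

(** The family of input strings is arbitrary, as long as each position depends on at most [r]
    variables from [Y]. This serves both for inputs paired with witnesses and for codes of composed
    instances. [C] depends on [M] and [r] only. *)
Lemma tableau_cnf (M : machine) (r : nat) : exists C : nat,
  forall (I : Type) (str : I -> seq bool) (m T : nat) (Y : finType)
         (ival : I -> Y -> bool) (src : nat -> seq Y),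
    (forall i, size (str i) <= m) ->
    (forall p, size (src p) <= r) ->
    (forall p i j, {in src p, ival i =1 ival j} ->
       onth (str i) p = onth (str j) p) ->
  let B := C * (#|Y| + T.+1 * (m + T).+1) in
  #|tvar M m T Y| <= B /\
  exists f : cnf (tvar M m T Y),
    [/\ size f <= B, [::] \notin f,
        forall i, sat (tabval str ival i) f
      & forall a i, sat a f -> (forall y, a (inl y) = ival i y) ->
                    a =1 tabval str ival i].
Proof.
set D := #|state M| + (extra_tapes M).+1 * 3 * #|symbol (work M)| + 1.
set r' := r + deps_bound M.
exists (D * (2 ^ r' * 2)) => I str m T Y ival src size_str size_src loc B.
have cardB : #|tvar M m T Y| <= D * (#|Y| + T.+1 * (m + T).+1).
  rewrite card_tvar /D; move: #|Y| #|state M| (extra_tapes M).+1.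
  by move=> y s k; move: #|symbol _| (m + T) => w u; nia.
have exp_gt0 : 0 < 2 ^ r' * 2 by rewrite muln_gt0 expn_gt0.
split; first by apply: leq_trans cardB _; rewrite /B; nia.
exists (@circuit_cnf _ _ (tabval str ival) (@tgate M m T Y) (tdeps src) r').
split.
- apply: leq_trans (size_circuit_cnf _ _ _ _) _.
  by rewrite /B -mulnA; nia.
- exact: circuit_cnf_nonempty.
- by move=> i; apply: circuit_cnf_val; apply: size_tdeps.
- move=> a i sat_a a_inp; apply: (circuit_cnf_unique _ _ _ sat_a).
  + exact: trank_deps.
  + exact: size_tdeps.
  + exact: tabval_local.
  + by case=> // y _; apply: a_inp.
Qed.

(** * Languages in NP as formulas *)

Lemma onth_if T (x0 : T) s p :
  onth s p = if p < size s then Some (nth x0 s p) else None.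
Proof. by elim: s p => [|x s IHs] [|p] //=; rewrite IHs. Qed.

Lemma onth_enc_pair x w p :
  onth (enc_pair (x, w)) p =
  if p < (size x).*2 then Some (odd p ==> nth false x p./2)
  else if p == (size x).*2 then Some false
  else onth w (p - (size x).*2.+1).
Proof.
rewrite /enc_pair /=; elim: x p => [|b x IHx] [|[|p]] //.
by rewrite /= IHx negbK.
Qed.

Lemma size_enc_pair x w : size (enc_pair (x, w)) = (size x).*2.+1 + size w.
Proof.
rewrite /enc_pair size_cat /=; elim: x => [|b x IHx] //=.
by rewrite -[RHS]/(((size x).*2.+1 + size w).+2) -IHx.
Qed.

Lemma iter_halted (M : machine) (c : config M) t t' :
  halting (iter t (@step M) c).1 -> t <= t' ->
  iter t' (@step M) c = iter t (@step M) c.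
Proof.
move=> ht /subnK <-; elim: (t' - t) => // d IHd.
by rewrite addSn iterS IHd /step ht.
Qed.

Lemma outputs_withinW (M : machine) x y t t' :
  t <= t' -> outputs_within M x y t -> outputs_within M x y t'.
Proof. by move=> le_t [ht eqy]; rewrite /outputs_within (iter_halted ht). Qed.

(* A nonuniform form of NP: the inputs of length [n] are the first [n]
   variables of a polynomial-size formula that depends only on [n]. *)
Definition poly_cnf (L : language) : Prop :=
  exists2 B : nat -> nat, pbounded B &
  forall n, exists (Z : finType) (f : cnf ('I_n + Z)),
    [/\ #|Z| <= B n, size f <= B n, [::] \notin f
      & forall x : n.-tuple bool,
          L x <-> exists2 a, sat a f & forall b, a (inl b) = tnth x b].

(** * Inputs paired with witnesses of bounded length *)

Section WitnessCoding.

Variables n P : nat.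

(** Witnesses may be shorter than [P]: the first copy of ['I_P] holds the length in unary, the
    second one the bits, padded to length [P]. *)
Definition wvar : finType := ('I_n + ('I_P + 'I_P))%type.

Definition winput : Type := (n.-tuple bool * (P.-tuple bool * 'I_P.+1))%type.

Definition witness (i : winput) : seq bool := take i.2.2 i.2.1.

Definition wval (i : winput) (v : wvar) : bool :=
  match v with
  | inl b => tnth i.1 b
  | inr (inl p) => p < i.2.2
  | inr (inr p) => tnth i.2.1 p
  end.

Definition wstr (i : winput) : seq bool := enc_pair (val i.1, witness i).

Definition wsrc (p : nat) : seq wvar :=
  if p < n.*2 then if insub p./2 is Some b then [:: inl b] else [::]
  else if insub (p - n.*2.+1) is Some b then [:: inr (inl b); inr (inr b)]
  else [::].

Lemma size_wsrc p : size (wsrc p) <= 2.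
Proof. by rewrite /wsrc; do 2![case: ifP => //= _|case: insubP => //=]. Qed.

Lemma size_witness i : size (witness i) = i.2.2.
Proof. by rewrite size_take size_tuple; case: ltnP => //; have := ltn_ord i.2.2; lia. Qed.

Lemma witness_surj x w :
  size w <= P -> exists2 i : winput, i.1 = x & witness i = w.
Proof.
move=> le_wP.
have size_u : size (w ++ nseq (P - size w) false) == P.
  by rewrite size_cat size_nseq subnKC.
have lt_w : size w < P.+1 by [].
exists (x, (Tuple size_u, Ordinal lt_w)) => //.
by rewrite /witness /= take_size_cat.
Qed.

Lemma wstr_local p i j :
  {in wsrc p, wval i =1 wval j} -> onth (wstr i) p = onth (wstr j) p.
Proof.
rewrite /wstr !onth_enc_pair !size_tuple /wsrc.
case: ltnP => [lt_pn|le_np].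
  have lt_p2 : p./2 < n by rewrite ltn_half_double.
  rewrite insubT /= => /(_ (inl (Ordinal lt_p2)) (mem_head _ _)).
  by rewrite /= !(tnth_nth false) /= => ->.
case: eqP => // _; rewrite !(onth_if false) !size_witness.
case: insubP => [b _ <-|].
  move=> eqv; have /= eql := eqv (inr (inl b)) (mem_head _ _).
  have /= := eqv (inr (inr b)) (mem_last (inr (inl b)) [:: inr (inr b)]).
  rewrite !(tnth_nth false) -eql; case: ifP => // lt_b eqb.
  by rewrite !nth_take -?eql // eqb.
rewrite -leqNgt => le_P _.
by rewrite !ltnNge !(leq_trans _ le_P) // -ltnS ltn_ord.
Qed.

(** Each clause is an implication from the larger of two indices to the smaller one, so the true
    length indicators form an initial segment. *)
Definition length_cnf : cnf ('I_P + 'I_P) :=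
  [seq [:: (inl (if p <= q then p else q), true);
           (inl (if p <= q then q else p), false)]
  | p : 'I_P <- enum 'I_P, q : 'I_P <- enum 'I_P].

Lemma size_length_cnf : size length_cnf = P * P.
Proof. by rewrite size_allpairs size_enum_ord. Qed.

Lemma sat_length_cnf i : sat (wval i \o inr) length_cnf.
Proof.
apply/allP => c /allpairsP[[p q] [_ _ ->]] /=; rewrite /sat_clause /=.
by case: i => [x [u k]] /=; case: ifP => /=; lia.
Qed.

Lemma length_cnf_wval (a : wvar -> bool) :
  sat (a \o inr) length_cnf -> exists i, a =1 wval i.
Proof.
move=> /allP sat_a.
(* The indicators are continued by [false], so a first false index exists and is at most [P]; it is
   the length. *)
pose ln p := if insub p is Some b then a (inr (inl b)) else false.
have exN : exists p, ~~ ln p by exists P; rewrite /ln insubF ?ltnn.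
case: (ex_minnP exN) => k lnk mink.
have lt_kP : k < P.+1 by apply: mink; rewrite /ln insubF ?ltnn.
exists ([tuple a (inl b) | b < n],
        ([tuple a (inr (inr p)) | p < P], Ordinal lt_kP)).
case=> [b|[p|p]]; rewrite /= ?tnth_mktuple //.
have lnE : a (inr (inl p)) = ln p by rewrite /ln valK.
rewrite lnE; case: ltnP => [lt_pk|le_kp].
  by apply: contraTT lt_pk => /mink; rewrite -leqNgt.
apply/negP => lnp; move: lnk.
have {}lt_kP : k < P by apply: leq_ltn_trans le_kp _.
rewrite /ln (insubT (fun p => p < P) lt_kP) => /negP; apply.
have /sat_a : [:: (inl (Ordinal lt_kP), true); (inl p, false)] \in length_cnf.
  by apply/allpairsP; exists (Ordinal lt_kP, p); rewrite !mem_enum /= le_kp.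
by rewrite /sat_clause /= lnE lnp !orbF => /eqP.
Qed.

End WitnessCoding.

Theorem NP_poly_cnf (L : language) : NP L -> poly_cnf L.
Proof.
move=> [V [p [[M [q MV]] LV]]].
have [C tabC] := tableau_cnf M 2.
pose P n := (p.[n])%R; pose m n := n.*2.+1 + P n; pose T n := (q.[m n])%R.
pose B n := C * (n + (P n + P n) + (T n).+1 * (m n + T n).+1) + P n * P n + 1.
have pP : pbounded P by apply: pbounded_horner pbounded_id.
have pm : pbounded m.
  apply: pboundedD pP; apply: pboundedS.
  by apply: pboundedW (pboundedD pbounded_id pbounded_id) => n; rewrite addnn.
have pT : pbounded T by apply: pbounded_horner.
exists B.
  apply: pboundedD (pbounded_cst 1); apply: pboundedD (pboundedM pP pP).
  apply: pboundedM (pbounded_cst C) _; apply: pboundedD.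
    exact: pboundedD pbounded_id (pboundedD pP pP).
  exact: pboundedM (pboundedS pT) (pboundedS (pboundedD pm pT)).
move=> n.
have size_str i : size (@wstr n (P n) i) <= m n.
  by rewrite size_enc_pair size_tuple size_witness leq_add2l -ltnS ltn_ord.
have [card_t [f [size_f ne_f sat_f uniq_f]]] :=
  tabC _ _ _ (T n) _ _ _ size_str (@size_wsrc n (P n)) (@wstr_local n (P n)).
rewrite !card_sum !card_ord in card_t size_f.
set tv := tvar _ _ _ _ in f size_f ne_f sat_f uniq_f.
pose Z : finType := (('I_(P n) + 'I_(P n)) +
                     'I_(T n).+1 * cbit M (m n + T n))%type.
pose h (v : tv) : 'I_n + Z :=
  match v with
  | inl (inl b) => inl b
  | inl (inr y) => inr (inl y)
  | inr g => inr (inr g)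
  end.
pose g (v : 'I_n + Z) : tv :=
  match v with
  | inl b => inl (inl b)
  | inr (inl y) => inl (inr y)
  | inr (inr g) => inr g
  end.
have hK : cancel h g by case=> [[]|].
(* The output is a single bit, so acceptance is read off the scanned cell of the first tape at time
   [T n]. *)
pose acc : tv := inr (ord_max, inr (ord0, None, Some (inl true))).
pose f' : cnf tv := [:: (acc, true)] :: f ++
  map_cnf (inl \o inr) (length_cnf (P n)).
exists Z, (map_cnf h f').
have accE i : tabval (@wstr n (P n)) (@wval n (P n)) i acc
              = V (val i.1, witness i).
  have [] : outputs_within M (wstr i) (enc_bool (V (val i.1, witness i))) (T n).
    apply: outputs_withinW (MV (val i.1, witness i)).
    exact: leq_horner_nat (size_str i).
  rewrite /= /output -/(run _ _ _) => _; rewrite /run /=.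
  case: (tcur _) => [[b|w]|] //= [->]; first by case: (V _).
split.
- rewrite card_sum card_sum !card_ord card_prod; move: card_t.
  by rewrite card_prod card_ord /B; lia.
- rewrite size_map /= size_cat size_map size_length_cnf /B.
  by rewrite addn1 ltnS leq_add2r.
- apply: map_cnf_nonempty; rewrite inE /= mem_cat (negPf ne_f) /=.
  by apply: map_cnf_nonempty; apply/negP => /allpairsP[[? ?] []].
move=> x; split.
  move/LV=> [w [le_w Vw]].
  rewrite size_tuple in le_w; have [i i1 iw] := witness_surj x le_w.
  exists (tabval (@wstr n (P n)) (@wval n (P n)) i \o g); last by rewrite -i1.
  rewrite sat_map (@eq_sat _ _ (tabval (@wstr _ _) (@wval _ _) i)); last first.
    by move=> v /=; rewrite hK.
  rewrite /= -/(sat _ _) sat_cat sat_f sat_map.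
  have /= -> := accE i; rewrite i1 iw Vw /=.
  exact: (sat_length_cnf i).
move=> [a sat_a ax]; apply/LV; move: sat_a; rewrite sat_map /= -/(sat _ _) sat_cat.
case/and3P=> acc_a sat_a; rewrite sat_map => len_a.
have [i ai] := @length_cnf_wval n (P n) (a \o h \o inl) len_a.
have ah := uniq_f _ _ sat_a ai.
have eqx : i.1 = x.
  by apply: eq_from_tnth => b; rewrite -ax; have /= <- := ai (inl b).
exists (witness i); rewrite size_witness size_tuple -ltnS ltn_ord; split=> //.
by move: acc_a; rewrite orbF -[a _]/((a \o h) acc) ah accE eqx => /eqP.
Qed.

(** * From hitting sets to identifying codes *)

Definition in_nbhd (T : eqType) (e : rel T) (v w : T) : bool :=
  (w == v) || e v w.

(** Stated over any finite type, so that graphs can be built on sum types. *)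
Definition code (T : finType) (e : rel T) (I : {set T}) : Prop :=
  (forall v, exists2 w, w \in I & in_nbhd e v w) /\
  (forall u v, u != v ->
     exists2 w, w \in I & in_nbhd e u w != in_nbhd e v w).

Lemma identifying_codeP (G : graph) (I : {set 'I_(nverts G)}) :
  identifying_code I <-> code (@adj G) I.
Proof.
have nbE v w : (w \in closed_nbhd v) = in_nbhd (@adj G) v w by rewrite inE.
split=> -[dom sep]; split.
- move=> v; have /set0Pn[w] := dom v; rewrite inE nbE => /andP[vw wI].
  by exists w.
- move=> u v /sep; apply: contraPP => nex.
  apply/negP; rewrite negbK; apply/eqP/setP => w; rewrite !in_setI !nbE.
  case wI : (w \in I); last by rewrite !andbF.
  by rewrite !andbT; apply: contra_notP nex => /eqP ne; exists w.
- move=> v; have [w wI vw] := dom v.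
  by apply/set0Pn; exists w; rewrite in_setI nbE vw.
- move=> u v /sep[w wI]; apply: contraNneq => /setP/(_ w).
  by rewrite !in_setI !nbE wI !andbT => ->.
Qed.

Section FinGraph.

Variables (T : finType) (e : rel T).
Hypothesis (e_sym : symmetric e) (e_irr : irreflexive e).

Definition ord_adj (u v : 'I_#|T|) : bool := e (enum_val u) (enum_val v).

Lemma ord_adj_sym : symmetric ord_adj.
Proof. by move=> u v; apply: e_sym. Qed.

Lemma ord_adj_irr : irreflexive ord_adj.
Proof. by move=> u; apply: e_irr. Qed.

Definition fin_graph : graph := Graph ord_adj_sym ord_adj_irr.

Lemma IdentifyingCode_fin_graph k :
  IdentifyingCode (fin_graph, k) <-> exists2 I, code e I & #|I| <= k.
Proof.
have nbE (u v : 'I_#|T|) : in_nbhd ord_adj u v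
    = in_nbhd e (enum_val u) (enum_val v).
  by rewrite /in_nbhd (inj_eq enum_val_inj).
split=> [[I [/identifying_codeP[dom sep] le_Ik]]|[I [dom sep] le_Ik]].
  exists (enum_val @: I); last by apply: leq_trans (leq_imset_card _ _) le_Ik.
  split=> [v|u v ne_uv].
    have [w wI] := dom (enum_rank v); rewrite nbE enum_rankK => vw.
    by exists (enum_val w) => //; apply: imset_f.
  have [|w wI] := sep (enum_rank u) (enum_rank v).
    by rewrite (inj_eq enum_rank_inj).
  rewrite !nbE !enum_rankK => vw.
  by exists (enum_val w) => //; apply: imset_f.
exists (enum_rank @: I); split; last first.
  by apply: leq_trans (leq_imset_card _ _) le_Ik.
apply/identifying_codeP; split=> [v|u v ne_uv].
  have [w wI vw] := dom (enum_val v).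
  by exists (enum_rank w); rewrite ?imset_f // nbE enum_rankK.
have [|w wI vw] := sep (enum_val u) (enum_val v).
  by rewrite (inj_eq enum_val_inj).
by exists (enum_rank w); rewrite ?imset_f // !nbE enum_rankK.
Qed.

Lemma vc_fin_graph (C : {set T}) :
  (forall u v, e u v -> (u \in C) || (v \in C)) -> vc fin_graph <= #|C|.
Proof.
move=> covC; rewrite /vc; case: arg_minnP => [|I _ minI].
  by apply/forallP => u; apply/forallP => v; rewrite !inE implybT.
have le_C : #|enum_rank @: C| <= #|C| by apply: leq_imset_card.
apply: leq_trans le_C; apply: minI.
apply/forallP => u; apply/forallP => v; apply/implyP => /covC.
by rewrite -{2}(enum_valK u) -{2}(enum_valK v) !mem_imset //;
  apply: enum_rank_inj.
Qed.

End FinGraph.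

Section HittingSetGraph.

Variables (U R D : finType) (S : R -> U -> bool) (sig : R -> {set D}).
Hypothesis S_nonempty : forall r, exists u, S r u.
Hypothesis sig_inj : injective sig.

(* Tags [(true, _)] belong to every signature below and tags [(false, _)] to
   none, which keeps these signatures apart from those of the vertices [D_e]
   and [g_o]. *)
Definition label : finType := ((U + D) + bool * bool)%type.

(* The vertices are called [D_e] for a label [e], [g_o] for an optional label
   [o], [u] for an element [u], and [f_(r, c)] for a set [r] and a bit [c]. *)
Definition vert : finType := (label + (option label + (U + R * bool)))%type.

Definition signature (v : U + R * bool) (e : label) : bool :=
  match v, e with
  | _, inr (b, _) => b
  | inl u, inl (inl u') => u == u'
  | inr (r, _), inl (inr d) => d \in sig r
  | _, _ => false
  end.

(** The [g_o] form a clique, and [g_None] and [g_(Some e)] are told apart by [D_e] alone, which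
    forces [D_e] into every code. The two vertices [f_(r, c)] see the same labels; besides
    themselves, only the elements of the set [r] tell them apart. *)
Definition half_adj (x y : vert) : bool :=
  match x, y with
  | inl e, inr (inl o) => o != Some e
  | inl e, inr (inr v) => signature v e
  | inr (inl o), inr (inl o') => o != o'
  | inr (inr (inl u)), inr (inr (inr (r, true))) => S r u
  | _, _ => false
  end.

Definition vert_adj (x y : vert) : bool := half_adj x y || half_adj y x.

Lemma vert_adj_sym : symmetric vert_adj.
Proof. by move=> x y; rewrite /vert_adj orbC. Qed.

Lemma vert_adj_irr : irreflexive vert_adj.
Proof.
by move=> [e|[o|[u|[r []]]]]; rewrite /vert_adj /= ?eqxx.
Qed.

Lemma in_nbhd_label v e :
  in_nbhd vert_adj v (inl e) =
  match v with
  | inl e' => e == e'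
  | inr (inl o) => o != Some e
  | inr (inr v) => signature v e
  end.
Proof. by case: v => [e'|[o|[u|[r c]]]]; rewrite /in_nbhd /vert_adj /= ?orbF. Qed.

(** Among the four tags, a [D_e] sees at most one, a [g_o] at least three, and every other vertex
    exactly two, which separates the kinds. Within a kind the other labels decide, by [sig_inj] in
    the case of the [f_(r, c)]. *)
Lemma same_labels v w :
    (forall e, in_nbhd vert_adj v (inl e) = in_nbhd vert_adj w (inl e)) ->
  v = w \/ exists r c c', v = inr (inr (inr (r, c))) /\
                          w = inr (inr (inr (r, c'))).
Proof.
pose t b c : label := inr (b, c).
have Dg (e : label) o : ~ forall e', (e' == e) = (o != Some e').
  move=> h; have := (h (t true true), h (t true false)).
  have := (h (t false true), h (t false false)).
  by case: e o {h} => [e|[[] []]] [[?|[[] []]]|] [? ?] [? ?].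
have Df (e : label) x : ~ forall e', (e' == e) = signature x e'.
  move=> h; have := (h (t true true), h (t true false)).
  have := (h (t false true), h (t false false)).
  by case: e x {h} => [e|[[] []]] [?|[? ?]] [? ?] [? ?].
have gf o x : ~ forall e' : label, (o != Some e') = signature x e'.
  move=> h; have := (h (t true true), h (t true false)).
  have := (h (t false true), h (t false false)).
  by case: o x {h} => [[?|[[] []]]|] [?|[? ?]] [? ?] [? ?].
case: v w => [e|[o|x]] [e'|[o'|x']] eqs;
  have {}eqs : forall e, _ = _ := fun e => etrans (esym (in_nbhd_label _ e))
    (etrans (eqs e) (in_nbhd_label _ e)).
- by left; congr inl; apply/eqP; rewrite -eqs.
- by case: (Dg _ _ eqs).
- by case: (Df _ _ eqs).
- by case: (Dg _ _ (fun e => esym (eqs e))).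
- left; congr (inr (inl _)); case: o o' eqs => [e|] [e'|] // eqs.
  + by have := eqs e; rewrite eqxx => /esym/negbFE/eqP ->.
  + by have := eqs e; rewrite eqxx.
  + by have := eqs e'; rewrite eqxx.
- by case: (gf _ _ eqs).
- by case: (Df _ _ (fun e => esym (eqs e))).
- by case: (gf _ _ (fun e => esym (eqs e))).
case: x x' eqs => [u|[r c]] [u'|[r' c']] eqs.
- by have /= := eqs (inl (inl u)); rewrite eqxx => /esym/eqP ->; left.
- by have /= := eqs (inl (inl u)); rewrite eqxx.
- by have /= := eqs (inl (inl u')); rewrite eqxx.
right; exists r, c, c'; split=> //; do 3 congr inr; congr pair.
by apply: sig_inj; apply/setP => d; have /= := eqs (inl (inr d)).
Qed.

(** The code consists of all [D_e] and of [H]: the labels dominate everything and separate all but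
    the pairs [f_(r, c)], which [H] separates. *)
Lemma code_of_hitting_set (H : {set U}) :
    (forall r, exists2 u, u \in H & S r u) ->
  exists2 I, code vert_adj I & #|I| <= #|label| + #|H|.
Proof.
move=> hit.
pose I : {set vert} :=
  [set inl e | e in label] :|: [set inr (inr (inl u)) | u in H].
exists I; last first.
  by apply: leq_trans (leq_card_setU _ _) _; apply: leq_add;
    apply: leq_imset_card.
have labI e : inl e \in I by rewrite inE imset_f.
split=> [v|v w ne_vw].
  suff [e ve] : exists e, in_nbhd vert_adj v (inl e) by exists (inl e).
  case: v => [e|[o|x]]; first by exists e; rewrite in_nbhd_label.
  - have [->|ne] := eqVneq o (Some (inr (true, true))).
      by exists (inr (true, false)); rewrite in_nbhd_label.
    by exists (inr (true, true)); rewrite in_nbhd_label.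
  - by exists (inr (true, true)); rewrite in_nbhd_label; case: x => [|[]].
have [[e ne]|same] := pselect (exists e,
    in_nbhd vert_adj v (inl e) != in_nbhd vert_adj w (inl e)).
  by exists (inl e).
have [|eq_vw|[r [c [c' [vE wE]]]]] := @same_labels v w.
- by move=> e; apply: contra_notP same => /eqP; exists e.
- by rewrite eq_vw eqxx in ne_vw.
have [u uH Sru] := hit r; exists (inr (inr (inl u))).
  by rewrite inE orbC imset_f.
rewrite vE wE /in_nbhd /vert_adj; move: ne_vw; rewrite vE wE.
by case: c c' {vE wE} => [] []; rewrite /= ?eqxx ?Sru.
Qed.

(** All [D_e] are forced, so at most [k] other vertices remain to separate the pairs [f_(r, c)]. *)
Lemma hitting_set_of_code (I : {set vert}) k :
    code vert_adj I -> #|I| <= #|label| + k ->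
  exists2 H : {set U}, (forall r, exists2 u, u \in H & S r u) & #|H| <= k.
Proof.
move=> [_ sep] le_I.
have gg o o' : in_nbhd vert_adj (inr (inl o)) (inr (inl o')).
  by rewrite /in_nbhd /vert_adj /=; have [->|] := eqVneq o o'; rewrite ?eqxx ?orbT.
have lab_sub : [set inl e | e in label] \subset I.
  apply/subsetP => _ /imsetP[e _ ->].
  have [//|w wI] := sep (inr (inl None)) (inr (inl (Some e))).
  case: w wI => [e'|[o|x]] wI.
  - rewrite !in_nbhd_label /= negbK; case: eqP => // -[->] //.
  - by rewrite !gg.
  - by case: x {wI} => [u|[r c]]; rewrite /in_nbhd /vert_adj.
(* A pair may also be separated by one of its own members, which is traded for an arbitrary element
   of its set. *)
pose rep (v : vert) : option U :=
  match v with
  | inr (inr (inl u)) => Some u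
  | inr (inr (inr (r, _))) => [pick u | S r u]
  | _ => None
  end.
exists [set u | Some u \in rep @: (I :\: [set inl e | e in label])].
  move=> r; have [|w wI] := sep (inr (inr (inr (r, true))))
                                (inr (inr (inr (r, false)))).
    by apply/eqP; case.
  have inH u : rep w = Some u ->
      u \in [set u | Some u \in rep @: (I :\: [set inl e | e in label])].
    move=> repw; rewrite inE -repw imset_f // inE wI andbT.
    by apply/imsetP => -[e _ we]; rewrite we in repw.
  case: w wI inH => [e|[o|[u|[r' c]]]] wI inH.
  - by rewrite !in_nbhd_label /=; case: e {wI inH} => [[?|?]|[? ?]]; rewrite eqxx.
  - by [].
  - rewrite /in_nbhd /vert_adj /= => ne; exists u; first exact: inH.
    by move: ne; case: (S r u).
  - rewrite /in_nbhd /vert_adj /= !orbF => ne.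
    have eq_r : r' = r.
      apply: contraNeq ne => ne_r.
      have neq c' : (inr (inr (inr (r', c))) == inr (inr (inr (r, c'))) :> vert)
                    = false by apply: contraNF ne_r => /eqP[->].
      by rewrite !neq.
    move: inH => /=; case: pickP => [u Su|S0].
      by exists u; [apply: inH|rewrite -eq_r].
    by have [u] := S_nonempty r'; rewrite S0.
rewrite -(leq_add2l #|label|) (leq_trans _ le_I) //.
rewrite -(cardsID [set inl e | e in label] I) (setIidPr lab_sub).
rewrite card_imset ?cardsT; last by move=> ? ? [].
rewrite leq_add //.
apply: leq_trans (leq_imset_card rep _).
rewrite -(card_imset _ (@Some_inj _)); apply: subset_leq_card.
by apply/subsetP => _ /imsetP[u + ->]; rewrite inE.
Qed.

End HittingSetGraph.

(** * Composing instances *)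

Section OrComposition.

Variables (n l : nat) (Z : finType) (f : cnf ('I_n + Z)).

Definition index_set : finType := {ffun 'I_l -> bool}.

Definition inputs : finType := {ffun index_set -> n.-tuple bool}.

Definition hvar : finType := (('I_n + Z) + 'I_l)%type.

(* The ground set consists of the literals of the variables of [f] and of [l]
   variables that select an index [j]. *)
Definition hset : finType :=
  ((hvar + 'I_(size f)) + index_set * 'I_n)%type.

(** With a budget of [#|hvar|], the sets of the variables make a hitting set choose exactly one
    literal each. The set [(j, b)] is then an implication: if the selectors spell [j], then input
    variable [b] has the value of bit [b] of [X j]. *)
Definition hits (X : inputs) (r : hset) (u : hvar * bool) : bool :=
  match r, u.1 with
  | inl (inl v), v' => v' == v
  | inl (inr c), inl x => (x, u.2) \in tnth (in_tuple f) c
  | inr (j, b), inl (inl b') => (b' == b) && (u.2 == tnth (X j) b)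
  | inr (j, _), inr i => u.2 != j i
  | _, _ => false
  end.

(** The [2 ^ l * n] sets [(j, b)] get distinct signatures out of only [n + l] labels, which keeps
    the parameter linear in [l]. *)
Definition hsig (r : hset) : {set (hvar + 'I_(size f)) + ('I_n + 'I_l)} :=
  match r with
  | inl q => [set inl q]
  | inr (j, b) => [set d | match d with
                           | inr (inl b') => b' == b
                           | inr (inr i) => j i
                           | inl _ => false
                           end]
  end.

Lemma hsig_inj : injective hsig.
Proof.
move=> [q|[j b]] [q'|[j' b']] /setP eqs.
- by have := eqs (inl q); rewrite !inE eqxx => /esym/eqP[->].
- by have := eqs (inl q); rewrite !inE eqxx.
- by have := eqs (inl q'); rewrite !inE eqxx.
congr (inr (_, _)); last by have := eqs (inr (inl b)); rewrite !inE eqxx => /esym/eqP.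
by apply/ffunP => i; have := eqs (inr (inr i)); rewrite !inE.
Qed.

Lemma hits_nonempty X r : [::] \notin f -> exists u, hits X r u.
Proof.
move=> f_nonempty.
case: r => [[v|c]|[j b]].
- by exists (v, true); rewrite /hits /=.
- case cE : (tnth (in_tuple f) c) => [|[x b] s].
    by case/negP: f_nonempty; rewrite -cE mem_tnth.
  by exists (inl x, b); rewrite /hits /= cE mem_head.
- by exists (inl (inl b), tnth (X j) b); rewrite /hits /= !eqxx.
Qed.

Lemma hitting_setP X :
  (exists2 H : {set hvar * bool},
     forall r, exists2 u, u \in H & hits X r u & #|H| <= #|hvar|) <->
  exists j a, sat a f /\ forall b, a (inl b) = tnth (X j) b.
Proof.
split=> [[H hitH le_H]|[j [a [sat_a aX]]]]; last first.
  pose A (v : hvar) := match v with inl x => a x | inr i => j i end.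
  exists [set (v, A v) | v in hvar]; last exact: leq_imset_card.
  have inH v : (v, A v) \in [set (v, A v) | v in hvar] by rewrite imset_f.
  move=> [[v|c]|[j' b]].
  - by exists (v, A v); rewrite // /hits /=.
  - have /allP/(_ _ (mem_tnth c (in_tuple f)))/hasP[[x b] xc /= /eqP ab] := sat_a.
    by exists (inl x, A (inl x)) => //; rewrite /hits /= ab.
  - have [->|/eqP ne_j] := eqVneq j' j.
      by exists (inl (inl b), A (inl (inl b))); rewrite // /hits /= aX !eqxx.
    have [i ne_i] : exists i, j' i != j i.
      by apply: contra_notP ne_j => nex; apply/ffunP => i;
        apply: contra_notP nex => /eqP; exists i.
    by exists (inr i, A (inr i)); rewrite // /hits /= eq_sym.
(* [H] hits each of the [#|hvar|] variables and is no larger, so no variable occurs with both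
   signs. *)
have fst_inj : {in H &, injective fst}.
  apply/imset_injP; rewrite eqn_leq leq_imset_card (leq_trans le_H) //.
  rewrite -cardsT; apply: subset_leq_card; apply/subsetP => v _.
  have [u uH /eqP uv] := hitH (inl (inl v)).
  by rewrite -uv; apply: imset_f.
pose A v := (v, true) \in H.
have AE u : u \in H -> A u.1 = u.2.
  case: u => v [] //= vH; apply/negP => vH'.
  by have := fst_inj _ _ vH vH' erefl.
exists [ffun i => A (inr i)], (A \o inl); split=> [|b].
  apply/(all_nthP [::]) => c lt_c.
  have [[[x|i] b] uH] := hitH (inl (inr (Ordinal lt_c))); last by [].
  rewrite /hits /= (tnth_nth [::]) /= => xc.
  by apply/hasP; exists (x, b); rewrite //= (AE _ uH) eqxx.
have [[[[b'|//]|i] c] uH] := hitH (inr ([ffun i => A (inr i)], b)).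
  by rewrite /hits /= => /andP[/eqP <- /eqP <-]; rewrite (AE _ uH).
by rewrite /hits /= ffunE (AE _ uH) eqxx.
Qed.

Local Notation E := (label (hvar * bool)%type
                           ((hvar + 'I_(size f)) + ('I_n + 'I_l))%type).
Local Notation V := (vert (hvar * bool)%type hset
                          ((hvar + 'I_(size f)) + ('I_n + 'I_l))%type).

Definition or_graph (X : inputs) : graph :=
  fin_graph (vert_adj_sym (hits X) hsig) (vert_adj_irr (hits X) hsig).

Definition or_instance (X : inputs) : instance :=
  (or_graph X, #|E| + #|hvar|).

Lemma or_instanceP X : [::] \notin f ->
  IdentifyingCode (or_instance X) <->
  exists j a, sat a f /\ forall b, a (inl b) = tnth (X j) b.
Proof.
move=> f_nonempty; rewrite -hitting_setP; split.
  case/IdentifyingCode_fin_graph => I codeI le_I.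
  by have := hitting_set_of_code (fun r => hits_nonempty X r f_nonempty) codeI; apply.
case=> H hitH le_H; apply/IdentifyingCode_fin_graph.
have [I codeI le_I] := code_of_hitting_set hsig_inj hitH.
by exists I; rewrite // (leq_trans le_I) // leq_add2l.
Qed.

Definition or_size : nat := n + #|Z| + size f + l + 1.

Lemma card_hvar : #|hvar| = n + #|Z| + l.
Proof. by rewrite !card_sum !card_ord. Qed.

Lemma card_label_leq : #|E| <= 5 * or_size.
Proof.
rewrite !card_sum !card_prod !card_bool !card_ord -/hvar !card_sum !card_ord.
by rewrite /or_size; lia.
Qed.

(** Only the vertices [f_(r, c)] grow in number with [2 ^ l], and they are pairwise non-adjacent;
    all other vertices form a vertex cover. *)
Lemma or_instance_parameter X : vc_plus_k (or_instance X) <= 20 * or_size.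
Proof.
pose F (x : E + (option E + hvar * bool)) : V :=
  match x with
  | inl e => inl e
  | inr (inl o) => inr (inl o)
  | inr (inr u) => inr (inr (inl u))
  end.
have : vc (or_graph X) <= #|F @: setT|.
  apply: vc_fin_graph => u v.
  have [uF|] := boolP (u \in F @: setT) => // uF.
  have [//|] := boolP (v \in F @: setT) => vF.
  have {uF} [r ->] : exists r, u = inr (inr (inr r)).
    case: u uF => [e|[o|[w|r]]]; last by exists r.
    - by rewrite (imset_f F (in_setT (inl e))).
    - by rewrite (imset_f F (in_setT (inr (inl o)))).
    - by rewrite (imset_f F (in_setT (inr (inr w)))).
  have {vF} [r' ->] : exists r, v = inr (inr (inr r)).
    case: v vF => [e|[o|[w|r']]]; last by exists r'.
    - by rewrite (imset_f F (in_setT (inl e))).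
    - by rewrite (imset_f F (in_setT (inr (inl o)))).
    - by rewrite (imset_f F (in_setT (inr (inr w)))).
  by case: r r' => [r []] [r' []].
move=> /leq_trans/(_ (leq_imset_card _ _)).
have -> : #|[set: E + (option E + hvar * bool)]|
          = #|E| + (#|E|.+1 + #|hvar| * 2).
  rewrite cardsT card_sum [X in _ + X = _]card_sum.
  rewrite [X in _ + (X + _) = _]card_option.
  by rewrite [X in _ + (_ + X) = _]card_prod card_bool.
rewrite /vc_plus_k -[vc _ + _]/(vc (or_graph X) + (#|E| + #|hvar|)).
have := card_label_leq; have := card_hvar.
by rewrite /or_size; move: #|E| (vc _) => e c; lia.
Qed.

(* The code of the composed instance is a list of bits each of which is a
   constant or compares a constant with one bit of [X]. *)
Definition entry : finType := (bool + index_set * 'I_n * bool)%type.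

Definition entry_val (X : inputs) (t : entry) : bool :=
  match t with
  | inl b => b
  | inr (jb, c) => c == tnth (X jb.1) jb.2
  end.

(** In the default case [hits] does not depend on [X], so a dummy tuple is supplied. *)
Definition hits_entry (r : hset) (u : hvar * bool) : entry :=
  match r, u.1 with
  | inr (j, b), inl (inl b') =>
      if b' == b then inr ((j, b), u.2) else inl false
  | _, _ => inl (hits [ffun=> [tuple false | _ < n]] r u)
  end.

Lemma hits_entryE X r u : entry_val X (hits_entry r u) = hits X r u.
Proof.
case: r u => [[v|c]|[j b]] [[[b'|z]|i] c'] //=.
by rewrite /hits_entry /hits /=; case: (b' == b).
Qed.

Definition adj_entry (x y : V) : entry :=
  match x, y with
  | inr (inr (inl u)), inr (inr (inr (r, true))) => hits_entry r u
  | inr (inr (inr (r, true))), inr (inr (inl u)) => hits_entry r u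
  | _, _ => inl (vert_adj (fun _ _ => false) hsig x y)
  end.

Lemma adj_entryE X x y : entry_val X (adj_entry x y) = vert_adj (hits X) hsig x y.
Proof.
by case: x y => [?|[?|[?|[? []]]]] [?|[?|[?|[? []]]]] //=;
  rewrite hits_entryE /vert_adj /= ?orbF.
Qed.

Definition or_template : seq entry :=
  (nseq #|V| (inl true) ++ inl false ::
   [seq adj_entry (enum_val u) (enum_val v) | u <- enum 'I_#|V|, v <- enum 'I_#|V|])
  ++ nseq (#|E| + #|hvar|) (inl true).

Lemma enc_or_instance X :
  enc_instance (or_instance X) = [seq entry_val X t | t <- or_template].
Proof.
rewrite /enc_instance /enc_graph /or_template /= !map_cat /= !map_nseq.
congr ((_ ++ _ :: _) ++ _); rewrite map_allpairs.
by apply: eq_allpairs => u v; rewrite adj_entryE.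
Qed.

Lemma size_or_template :
  size or_template <= 1000 * (or_size + 2 ^ l * n) * (or_size + 2 ^ l * n).
Proof.
rewrite /or_template size_cat size_cat /= !size_nseq size_allpairs size_enum_ord.
have cardV : #|V| <= 20 * (or_size + 2 ^ l * n).
  have -> : #|V| = #|E| + (#|E|.+1 + (#|hvar| * 2 +
                   (#|hvar| + size f + 2 ^ l * n) * 2)).
    rewrite card_sum [X in _ + X = _]card_sum [X in _ + (_ + X) = _]card_sum.
    rewrite [X in _ + (X + _) = _]card_option.
    rewrite [X in _ + (_ + (X + _)) = _]card_prod.
    rewrite [X in _ + (_ + (_ + X)) = _]card_prod card_bool.
    rewrite [X in _ + (_ + (_ + X * _)) = _]card_sum.
    rewrite [X in _ + (_ + (_ + (X + _) * _)) = _]card_sum.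
    rewrite [X in _ + (_ + (_ + (_ + X) * _)) = _]card_prod.
    by rewrite card_ffun card_bool !card_ord.
  have := card_label_leq; have := card_hvar.
  by rewrite /or_size; move: #|E| (2 ^ l * n) => e c; lia.
have le_h : #|hvar| <= or_size by rewrite card_hvar /or_size; lia.
have s_gt0 : 0 < or_size by rewrite /or_size addn1.
have := leq_mul cardV cardV; have := card_label_leq; move: cardV le_h s_gt0.
move: #|E| #|hvar| (2 ^ l * n) #|V| or_size => e h c v s *.
have : s + c <= (s + c) * (s + c) by rewrite leq_pmull // addn_gt0; apply/orP; left.
by nia.
Qed.

End OrComposition.

(** * Covering the no-instances *)

Lemma nseq_cat_inj n n' s s' :
  nseq n true ++ false :: s = nseq n' true ++ false :: s' -> n = n' /\ s = s'.
Proof.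
elim: n n' => [|n IHn] [|n'] //=; first by case=> ->.
by case=> /IHn[-> ->].
Qed.

Lemma allpairs_eq (T : eqType) (T' : Type) (f g : T -> T -> T') s t :
  [seq f x y | x <- s, y <- t] = [seq g x y | x <- s, y <- t] ->
  {in s & t, f =2 g}.
Proof.
elim: s => [|x s IHs] //= eqs u v.
have eq1 : [seq f x y | y <- t] = [seq g x y | y <- t].
  have := congr1 (take (size t)) eqs.
  by rewrite !take_size_cat ?size_map.
rewrite inE => /predU1P[->|us] vt; first by move/eq_in_map: eq1 => ->.
apply: IHs => //; have := congr1 (drop (size t)) eqs.
by rewrite !drop_size_cat ?size_map.
Qed.

(** The unary prefix gives the number of vertices, the total length then gives [k], and the matrix
    the adjacency. This recovers a kernel from the bits that the machine outputs. *)
Lemma enc_instance_inj : injective enc_instance.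
Proof.
move=> [[n e sym irr] k] [[n' e' sym' irr'] k'].
rewrite /enc_instance /enc_graph /= -!catA !cat_cons => /nseq_cat_inj[eq_n].
rewrite -{n'}eq_n in e' sym' irr' *.
set A := [seq e u v | u <- _, v <- _]; set A' := [seq e' u v | u <- _, v <- _].
have size_A : size A = size A' by rewrite !size_allpairs.
move=> eqs; have eq_k : k = k'.
  have := congr1 size eqs; rewrite !size_cat !size_nseq size_A.
  exact: addnI.
have eq_A : A = A'.
  by have := congr1 (take (size A)) eqs; rewrite take_size_cat // size_A take_size_cat.
have eq_e : e = e'.
  by apply/funext => u; apply/funext => v; apply: (allpairs_eq eq_A); rewrite mem_enum.
clear A A' size_A eqs eq_A.
rewrite eq_k; rewrite -{e'}eq_e in sym' irr' *.
by rewrite (Prop_irrelevance sym sym') (Prop_irrelevance irr irr').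
Qed.

Section Covering.

Variables (T J Y : finType) (F : {ffun J -> T} -> Y).
Hypothesis card_Y : #|Y| < 2 ^ #|J|.

Definition fiber_points (A : {set T}) (y : Y) : {set T} :=
  [set x in A | [exists X, [&& X \in ffun_on (mem A), F X == y & x \in codom X]]].

(* Otherwise each fiber of [F] over [A ^ J] lies in a power of a set with less
   than half of the points of [A]. *)
Lemma exists_large_fiber (A : {set T}) :
  0 < #|A| -> exists y, #|A| <= 2 * #|fiber_points A y|.
Proof.
move=> A_gt0; apply: contrapT => nex.
have small y : 2 * #|fiber_points A y| <= #|A|.
  by rewrite ltnW // ltnNge; apply/negP => le_A; apply: nex; exists y.
have sub y : #|[set X in ffun_on (mem A) | F X == y]| <= #|fiber_points A y| ^ #|J|.
  rewrite -card_ffun_on; apply/subset_leq_card/subsetP => X.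
  rewrite inE => /andP[XA FX]; apply/ffun_onP => j; rewrite inE (ffun_onP XA) /=.
  by apply/existsP; exists X; rewrite XA FX codom_f.
have cardE : #|A| ^ #|J| = \sum_y #|[set X in ffun_on (mem A) | F X == y]|.
  rewrite -(card_ffun_on J (mem A)) -sum1_card (partition_big F predT) //=.
  by apply: eq_bigr => y _; rewrite sum1dep_card.
have : 2 ^ #|J| * #|A| ^ #|J| <= #|Y| * #|A| ^ #|J|.
  rewrite {1}cardE big_distrr /= -sum_nat_const leq_sum // => y _.
  apply: leq_trans (leq_mul (leqnn _) (sub y)) _.
  by rewrite -expnMn; case: #|J| => [|k]; rewrite ?expn0 // leq_exp2r // small.
by rewrite leq_pmul2r ?expn_gt0 ?A_gt0 // leqNgt card_Y.
Qed.

(** Removing the points of a large fiber at least halves [A], so [k] rounds exhaust it. Later rounds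
    use tuples over subsets of [A], so every [y] in [ys] is the image of a tuple over [A]. *)
Lemma small_cover k (A : {set T}) : #|A| < 2 ^ k ->
  exists ys : seq Y, [/\ size ys <= k,
    forall y, y \in ys -> exists2 X : {ffun J -> T}, forall j, X j \in A & F X = y
  & forall x, x \in A -> exists X : {ffun J -> T},
      [/\ forall j, X j \in A, exists j, X j = x & F X \in ys]].
Proof.
elim: k A => [|k IHk] A ltA.
  exists [::]; split=> // x xA.
  by move: ltA; rewrite expn0 ltnS leqn0 cards_eq0 => /eqP A0; rewrite A0 inE in xA.
have [->|A_neq0] := eqVneq A set0.
  by exists [::]; split=> // x; rewrite inE.
have A_gt0 : 0 < #|A| by rewrite card_gt0.
have [y le_A] := exists_large_fiber A_gt0.
have subC : fiber_points A y \subset A by apply/subsetP => x; rewrite inE => /andP[].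
have [|ys [size_ys ys_src ys_cov]] := IHk (A :\: fiber_points A y).
  rewrite cardsD (setIidPr subC); move: ltA; rewrite expnS.
  by have := subset_leq_card subC; lia.
have subD x : x \in A :\: fiber_points A y -> x \in A by rewrite inE => /andP[].
have C_src x : x \in fiber_points A y -> exists X : {ffun J -> T},
    [/\ forall j, X j \in A, exists j, X j = x & F X = y].
  rewrite inE => /andP[_ /existsP[X /and3P[/ffun_onP XA /eqP FX /codomP[j xj]]]].
  by exists X; split=> //; exists j.
exists (y :: ys); split=> //.
- move=> z; rewrite inE => /predU1P[->|/ys_src[X XA FX]]; last first.
    by exists X => // j; apply: subD.
  have /card_gt0P[x /C_src[X [XA _ FX]]] : 0 < #|fiber_points A y| by lia.
  by exists X.
- move=> x xA; have [/C_src[X [XA xX FX]]|xC] := boolP (x \in fiber_points A y).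
    by exists X; split=> //; rewrite FX mem_head.
  have [|X [XA xX FX]] := ys_cov x; first by rewrite inE xC.
  by exists X; split=> //; [move=> j; apply: subD|rewrite inE FX orbT].
Qed.

End Covering.

Lemma card_bseq_bool s : #|{bseq s of bool}| < 2 ^ s.+1.
Proof.
rewrite card_bseq card_bool; elim: s => [|s IHs]; first by rewrite big_ord1.
by rewrite big_ord_recr /= (expnS 2 s.+1) mul2n -addnn ltn_add2r.
Qed.

(** This makes an output test a conjunction of literals on single cells; the two negative ones say
    that the block ends after [y]. *)
Lemma leading_bits_eq (W : finType) (s : seq (symbol W)) (y : seq bool) :
  (leading_bits s == y) =
  [&& all (fun p => nth None s p == Some (inl (nth false y p))) (iota 0 (size y)),
      nth None s (size y) != Some (inl true)
    & nth None s (size y) != Some (inl false)].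
Proof.
elim: y s => [|b y IHy] [|[[c|w]|] s] //=; first by case: c.
rewrite eqseq_cons IHy (iotaDl 1) all_map /=.
by rewrite andbA; congr (_ && _ && _); case: c; case: b.
Qed.

(** * Distillation *)

Section OutputLiterals.

Variables (M : machine) (I : Type) (str : I -> seq bool) (m T : nat).
Variables (Y : finType) (ival : I -> Y -> bool).

Definition out_cell (p : nat) (s : symbol (work M)) : tvar M m T Y :=
  inr (ord_max,
       inr (ord0, if p is p'.+1 then Some (true, inord p') else None, s)).

Definition out_lits (y : seq bool) : seq (tvar M m T Y * bool) :=
  [:: (out_cell (size y) (Some (inl true)), false),
      (out_cell (size y) (Some (inl false)), false)
    & [seq (out_cell p (Some (inl (nth false y p))), true)
      | p <- iota 0 (size y)]].

Lemma size_out_lits y : size (out_lits y) = (size y).+2.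
Proof. by rewrite /= size_map size_iota. Qed.

Lemma out_cellE i p s : p <= m + T ->
  tabval str ival i (out_cell p s) =
  (let t := (run M str T i).2 ord0 in nth None (tcur t :: tright t) p == s).
Proof. by case: p => [|p] //= lt_p; rewrite inordK // ltnW. Qed.

Lemma out_litsP i y : size y <= m + T ->
  all (fun l => tabval str ival i l.1 == l.2) (out_lits y)
  = (output (run M str T i) == y).
Proof.
move=> le_y; rewrite /output leading_bits_eq.
have allE A (P : pred A) x r : all P (x :: r) = P x && all P r by [].
rewrite !allE all_map andbA andbC !(@out_cellE _ (size y)) // !eqbF_neg.
congr (_ && _); apply: eq_in_all => p; rewrite mem_iota => /andP[_ lt_p].
by rewrite -[LHS]/(_ == true) eqb_id out_cellE // ltnW // (leq_trans lt_p).
Qed.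

End OutputLiterals.

Lemma size_allpairs_dep_leq (S : Type) (T : S -> Type) (R : Type)
    (f : forall x, T x -> R) (s : seq S) (t : forall x, seq (T x)) c :
  (forall x, size (t x) <= c) -> size [seq f x y | x <- s, y <- t x] <= size s * c.
Proof.
move=> le_c; rewrite size_allpairs_dep; elim: s => //= x s IHs.
by rewrite mulSn leq_add.
Qed.

Section Distillation.

Variables (L : language) (K : instance -> instance) (M : machine).
Variables (n l s m T : nat) (Z : finType) (f : cnf ('I_n + Z)).
Hypothesis f_nonempty : [::] \notin f.
Hypothesis fP : forall x : n.-tuple bool,
  L x <-> exists2 a, sat a f & forall b, a (inl b) = tnth x b.
Hypothesis K_equiv : forall a, IdentifyingCode a <-> IdentifyingCode (K a).
Hypothesis size_K : forall X : inputs n l,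
  size (enc_instance (K (or_instance f X))) <= s.
Hypothesis MK : forall X : inputs n l,
  outputs_within M (enc_instance (or_instance f X))
                   (enc_instance (K (or_instance f X))) T.
Hypothesis size_tm : size (or_template l f) <= m.
Hypothesis le_sm : s <= m.
Hypothesis lt_s : s.+2 <= 2 ^ l.

Local Notation J := (index_set l).
Local Notation Fam := (inputs n l).

Definition dstr (X : Fam) : seq bool := enc_instance (or_instance f X).

Definition dval (X : Fam) (v : J * 'I_n) : bool := tnth (X v.1) v.2.

Definition dsrc (p : nat) : seq (J * 'I_n) :=
  if nth (inl true) (or_template l f) p is inr (v, _) then [:: v] else [::].

Lemma size_dstr X : size (dstr X) <= m.
Proof. by rewrite /dstr enc_or_instance size_map. Qed.

Lemma size_dsrc p : size (dsrc p) <= 1.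
Proof. by rewrite /dsrc; case: (nth _ _ _) => [|[]]. Qed.

Lemma dstr_local p X X' :
  {in dsrc p, dval X =1 dval X'} -> onth (dstr X) p = onth (dstr X') p.
Proof.
rewrite /dstr !enc_or_instance !(onth_if false) !size_map /dsrc => eqd.
case: ltnP => // lt_p; rewrite !(nth_map (inl true)) //; congr Some.
case: (nth _ _ _) eqd => [//|[v c]] /= /(_ v (mem_head _ _)).
by rewrite /dval => ->.
Qed.

Lemma or_instance_L (X : Fam) : IdentifyingCode (or_instance f X) <-> exists j, L (X j).
Proof.
rewrite or_instanceP //; split.
  by case=> j [a [sat_a aX]]; exists j; apply/fP; exists a.
by case=> j /fP[a sat_a aX]; exists j, a.
Qed.

Lemma output_run X : output (run M dstr T X) = enc_instance (K (or_instance f X)).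
Proof. by have [] := MK X. Qed.

Definition dout (X : Fam) : {bseq s of bool} := Bseq (size_K X).

Definition noset : {set n.-tuple bool} := [set x : n.-tuple bool | `[< ~ L x >]].

Lemma distillation_cover : exists ys : seq {bseq s of bool}, [/\ size ys <= n.+1,
    forall y, y \in ys -> exists2 X : Fam, forall j, ~ L (X j) & dout X = y
  & forall x : n.-tuple bool, ~ L x -> exists X : Fam,
      (exists j, X j = x) /\ dout X \in ys].
Proof.
have inA x : x \in noset <-> ~ L x.
  by rewrite inE; split=> [/asboolP|?]; last apply/asboolP.
(* There are fewer than [2 ^ s.+1] strings of length at most [s], while tuples have [2 ^ l]
   entries. *)
have cardY : #|{: {bseq s of bool}}| < 2 ^ #|J|.
  apply: leq_trans (card_bseq_bool s) _.
  rewrite card_ffun card_bool card_ord leq_exp2l //.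
  exact: ltnW.
have ltA : #|noset| < 2 ^ n.+1.
  apply: leq_ltn_trans (max_card _) _.
  by rewrite card_tuple card_bool ltn_exp2l.
have [ys [size_ys ys_src ys_cov]] := small_cover dout cardY ltA.
exists ys; split=> //.
- move=> y /ys_src[X XA FX]; exists X => // j; exact/inA.
- by move=> x /inA/ys_cov[X [_ xX FX]]; exists X.
Qed.

Variable C : nat.
Let V := tvar M m T (J * 'I_n)%type.
Let B := C * (2 ^ l * n + T.+1 * (m + T).+1).
Variable f0 : cnf V.
Hypothesis card_V : #|V| <= B.
Hypothesis size_f0 : size f0 <= B.
Hypothesis f0_nonempty : [::] \notin f0.
Hypothesis f0_sat : forall X, sat (tabval dstr dval X) f0.
Hypothesis f0_uniq : forall a X,
  sat a f0 -> (forall y, a (inl y) = dval X y) -> a =1 tabval dstr dval X.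

Section Formula.

Variable ys : seq {bseq s of bool}.

(** The selector [None], which the formula sets to false, keeps the clause that selects an output
    nonempty even if [ys] is empty. *)
Definition dvar : finType := (V + (J + option 'I_(size ys)))%type.

Definition tab_var (v : V) : 'I_n + dvar := inr (inl v).
Definition pos_sel (j : J) : 'I_n + dvar := inr (inr (inl j)).
Definition out_sel (q : option 'I_(size ys)) : 'I_n + dvar := inr (inr (inr q)).

(* The formula says that for some [X] and some index [j] the string [x]
   is [X j] and the kernel of the composition of [X] is one of the [ys]. *)
Definition pos_cnf : cnf ('I_n + dvar) :=
  [seq [:: (pos_sel t.1.1, false); (inl t.1.2, t.2);
           (tab_var (inl (t.1.1, t.1.2)), ~~ t.2)]
  | t : J * 'I_n * bool <- enum {: J * 'I_n * bool}].

Definition out_cnf : cnf ('I_n + dvar) :=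
  [seq [:: (out_sel (Some q), false); (tab_var v.1, v.2)]
  | q <- enum 'I_(size ys),
    v <- out_lits M m T (J * 'I_n)%type (tnth (in_tuple ys) q)].

Definition distill_cnf : cnf ('I_n + dvar) :=
  [:: [seq (pos_sel j, true) | j <- enum J],
      [seq (out_sel q, true) | q <- enum {: option 'I_(size ys)}],
      [:: (out_sel None, false)]
    & map_cnf tab_var f0 ++ pos_cnf ++ out_cnf].

Lemma sat_distill_cnf a :
  sat a distill_cnf =
  [&& sat_clause a [seq (pos_sel j, true) | j <- enum J],
      sat_clause a [seq (out_sel q, true) | q <- enum {: option 'I_(size ys)}],
      ~~ a (out_sel None), sat (a \o tab_var) f0, sat a pos_cnf & sat a out_cnf].
Proof.
rewrite -sat_map -!sat_cat -eqbF_neg -[a (out_sel None) == _]orbF.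
by rewrite /distill_cnf.
Qed.

Lemma card_dvar : size ys <= n.+1 -> #|dvar| <= B + 2 ^ l + n.+2.
Proof.
move=> le_ys; rewrite card_sum [X in _ + X <= _]card_sum card_option card_ord.
by rewrite card_ffun card_bool card_ord addnA !leq_add.
Qed.

Lemma size_distill_cnf :
  size ys <= n.+1 -> size distill_cnf <= B + 2 ^ l * n * 2 + n.+1 * s.+2 + 3.
Proof.
move=> le_ys.
have -> : size distill_cnf = (size f0 + (size pos_cnf + size out_cnf)).+3.
  by rewrite -[LHS]/((size (_ ++ _)).+3) !size_cat size_map.
have -> : size pos_cnf = 2 ^ l * n * 2.
  by rewrite size_map -cardT !card_prod card_ffun card_bool !card_ord.
rewrite addn3 !ltnS addnA !leq_add //.
apply: leq_trans (leq_mul le_ys (leqnn _)).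
rewrite -[X in X * _](size_enum_ord (size ys)); apply: size_allpairs_dep_leq => q.
by rewrite size_out_lits !ltnS size_bseq.
Qed.

Lemma distill_cnf_complete (x : n.-tuple bool) (X : Fam) j :
    X j = x -> dout X \in ys ->
  exists2 a, sat a distill_cnf & forall b, a (inl b) = tnth x b.
Proof.
move=> Xj yX; have /tnthP[q yq] : dout X \in in_tuple ys by [].
pose a (v : 'I_n + dvar) : bool :=
  match v with
  | inl b => tnth x b
  | inr (inl v) => tabval dstr dval X v
  | inr (inr (inl j')) => j' == j
  | inr (inr (inr q')) => q' == Some q
  end.
exists a => //; rewrite sat_distill_cnf f0_sat; apply/and5P; split=> //.
- by apply/hasP; exists (pos_sel j, true);
    [apply: map_f; rewrite mem_enum|rewrite /= eqxx].
- by apply/hasP; exists (out_sel (Some q), true);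
    [apply: map_f; rewrite mem_enum|rewrite /= eqxx].
apply/andP; split.
- apply/allP => c /mapP[[[j' b] d] _ ->]; rewrite /sat_clause /= /dval /=.
  by have [->|//] := eqVneq j' j; rewrite Xj; case: (tnth x b); case: d.
- apply/allP => c /allpairsPdep[q' [v [_ v_in ->]]]; rewrite /sat_clause /=.
  rewrite -[Some q' == Some q]/(q' == q); have [eq_q|//] := eqVneq q' q.
  move: v_in; rewrite eq_q -yq orbF => v_in.
  have /allP/(_ _ v_in) // : all (fun l => tabval dstr dval X l.1 == l.2)
      (out_lits M m T (J * 'I_n)%type (dout X)).
  rewrite out_litsP ?output_run //.
  by rewrite (leq_trans (size_bseq _)) // (leq_trans le_sm) // leq_addr.
Qed.

(** The assignment describes a tuple [X] through [x] with the same kernel as a tuple [X0] of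
    no-instances. A member of [L] in [X] would make that kernel, and hence the composition of [X0],
    a yes-instance. *)
Lemma distill_cnf_sound (x : n.-tuple bool) a :
    (forall y, y \in ys -> exists2 X : Fam, forall j, ~ L (X j) & dout X = y) ->
    sat a distill_cnf -> (forall b, a (inl b) = tnth x b) ->
  ~ L x.
Proof.
move=> ys_src; rewrite sat_distill_cnf => /and5P[]
  /hasP[_ /mapP[j _ ->] /= /eqP aj] /hasP[_ /mapP[q' _ ->] /= /eqP aq].
move=> aNone sat0 /andP[pos out] ax.
case: q' aq => [q|] aq; last by rewrite aq in aNone.
pose X : Fam := [ffun j => [tuple a (tab_var (inl (j, b))) | b < n]].
have aX : forall v, (a \o tab_var) (inl v) = dval X v.
  by case=> j' b; rewrite /dval ffunE tnth_mktuple.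
have aT := f0_uniq sat0 aX.
have Xj : X j = x.
  apply: eq_from_tnth => b; rewrite ffunE tnth_mktuple -ax.
  have in_pos c : [:: (pos_sel j, false); (inl b, c); (tab_var (inl (j, b)), ~~ c)]
      \in pos_cnf by apply/mapP; exists (j, b, c); rewrite ?mem_enum.
  have := allP pos _ (in_pos true); have := allP pos _ (in_pos false).
  rewrite /sat_clause /= aj !orbF /=.
  by case: (a (inl b)); case: (a (tab_var _)).
have out_X : output (run M dstr T X) = tnth (in_tuple ys) q.
  apply/eqP; rewrite -(@out_litsP _ _ _ m T _ dval); last first.
    by rewrite (leq_trans (size_bseq _)) // (leq_trans le_sm) // leq_addr.
  apply/allP => v v_in.
  have : [:: (out_sel (Some q), false); (tab_var v.1, v.2)] \in out_cnf.
    by apply/allpairsPdep; exists q, v; rewrite mem_enum.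
  by move/(allP out); rewrite /sat_clause /= aq orbF -aT.
have [X0 noX0 dX0] := ys_src _ (mem_tnth q (in_tuple ys)).
have eq_enc : enc_instance (K (or_instance f X)) = enc_instance (K (or_instance f X0)).
  by rewrite -output_run out_X -dX0.
rewrite -Xj => LXj.
have : IdentifyingCode (or_instance f X0).
  apply: (proj2 (K_equiv _)); rewrite -(enc_instance_inj eq_enc).
  apply: (proj1 (K_equiv _)).
  by apply/or_instance_L; exists j.
by case/or_instance_L => j' /noX0.
Qed.

Lemma distill_cnf_nonempty : [::] \notin distill_cnf.
Proof.
rewrite !inE !negb_or !mem_cat !negb_or map_cnf_nonempty //=.
apply/and4P; split.
- rewrite eq_sym -size_eq0 size_map -cardE -lt0n; apply/card_gt0P.
  by exists [ffun=> true].
- rewrite eq_sym -size_eq0 size_map -cardE -lt0n; apply/card_gt0P.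
  by exists None.
- by apply/mapP => -[].
- by apply/negP => /allpairsPdep[? [? []]].
Qed.

End Formula.

End Distillation.

Theorem poly_cnf_compl (L : language) :
  poly_kernel enc_instance IdentifyingCode vc_plus_k ->
  poly_cnf L -> poly_cnf (fun x => ~ L x).
Proof.
move=> [K [[M [q MK]] K_equiv [p pK]]] [b pb Lb].
have [C tabC] := tableau_cnf M 1.
(* The parameter of a composition is at most [20 * (s0 n + l)], hence at most [40 * N n] once
   [l <= N n]; the summand 2 provides [lt_s]. *)
have p40 : pbounded (fun z => (p.[(40 * z)%N])%R + 2).
  apply: pboundedD (pbounded_cst 2); apply: pbounded_horner.
  exact: pboundedM (pbounded_cst 40) pbounded_id.
(* The kernel size depends on [l], which in turn must exceed the logarithm of that size. Since
   [N n >= a], the bound [E n] is at most [2 ^ N n], so its logarithm can serve as [l]. *)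
have [p' pp'] := p40; have [a p'_exp] := horner_leq_exp2 p'.
pose s0 n := n + b n + b n + 1; pose N n := a + s0 n.
pose E n := (p'.[N n])%R; pose t n := 2 * E n; pose s n := (p.[(40 * N n)%N])%R.
pose w n := s0 n + N n + t n * n.
pose m n := 1000 * w n * w n + s n; pose T n := (q.[m n])%R.
pose Bd n := C * (t n * n + (T n).+1 * (m n + T n).+1).
pose B n := Bd n + t n + (t n * n * 2 + n.+1 * (s n).+2 + 3).
have ps0 : pbounded s0.
  exact: pboundedD (pboundedD (pboundedD pbounded_id pb) pb) (pbounded_cst 1).
have pN : pbounded N by exact: pboundedD (pbounded_cst a) ps0.
have pE : pbounded E by apply: pbounded_horner.
have pt : pbounded t by exact: pboundedM (pbounded_cst 2) pE.
have ps : pbounded s.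
  by apply: pbounded_horner; apply: pboundedM (pbounded_cst 40) pN.
have pw : pbounded w.
  exact: pboundedD (pboundedD ps0 pN) (pboundedM pt pbounded_id).
have pm : pbounded m.
  exact: pboundedD (pboundedM (pboundedM (pbounded_cst 1000) pw) pw) ps.
have pT : pbounded T by apply: pbounded_horner.
have pBd : pbounded Bd.
  apply: pboundedM (pbounded_cst C) _; apply: pboundedD.
    exact: pboundedM pt pbounded_id.
  exact: pboundedM (pboundedS pT) (pboundedS (pboundedD pm pT)).
exists B.
  apply: pboundedD (pboundedD pBd pt) _.
  apply: pboundedD _ (pbounded_cst 3); apply: pboundedD.
    exact: pboundedM (pboundedM pt pbounded_id) (pbounded_cst 2).
  exact: pboundedM (pboundedS pbounded_id) (pboundedS (pboundedS ps)).
move=> n; have [Z [f [card_Z size_f ne_f fP]]] := Lb n.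
have E_ge : s n + 2 <= E n by apply: pp'.
pose l := up_log 2 (E n).
have E_l : E n <= 2 ^ l by apply: up_logP.
have l_N : l <= N n by apply: up_log_min => //; apply: p'_exp; apply: leq_addr.
(* Rounding the logarithm up costs a factor of at most 2, so the tuples have polynomial length. *)
have l_t : 2 ^ l <= t n.
  have /andP[+ _] : 2 ^ l.-1 < E n <= 2 ^ l by apply: up_log_bounds; lia.
  have : 0 < l by rewrite up_log_gt0; lia.
  by rewrite /t; case: (l) => // k _; rewrite expnS /=; lia.
have size_le : or_size l f <= s0 n + l by rewrite /or_size /s0; lia.
have size_K (X : inputs n l) : size (enc_instance (K (or_instance f X))) <= s n.
  have [+ _] := pK (or_instance f X); move/leq_trans; apply.
  rewrite /s; apply: leq_horner_nat.
  apply: leq_trans (or_instance_parameter f X) _.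
  by move: size_le l_N; rewrite /N; lia.
have size_tm : size (or_template l f) <= m n.
  apply: leq_trans (size_or_template l f) _.
  have le_w : or_size l f + 2 ^ l * n <= w n.
    by rewrite /w; apply: leq_add; [lia|apply: leq_mul].
  have := leq_mul le_w le_w; rewrite /m; lia.
have MK' (X : inputs n l) : outputs_within M (enc_instance (or_instance f X))
    (enc_instance (K (or_instance f X))) (T n).
  apply: outputs_withinW (MK _); apply: leq_horner_nat.
  by rewrite enc_or_instance size_map.
have lt_s : (s n).+2 <= 2 ^ l by lia.
have le_sm : s n <= m n by apply: leq_addl.
have [card_V [f0 [size_f0 ne_f0 f0_sat f0_uniq]]] :=
  tabC _ _ (m n) (T n) _ _ _ (size_dstr size_tm) (@size_dsrc n l Z f)
       (@dstr_local n l Z f).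
rewrite card_prod card_ffun card_bool !card_ord in card_V size_f0.
have [ys [size_ys ys_src ys_cov]] := distillation_cover L size_K lt_s.
eexists; exists (distill_cnf f0 ys); split.
- apply: leq_trans (card_dvar card_V size_ys) _.
  rewrite -/(Bd n) /B /Bd; have : 2 ^ l * n <= t n * n by apply: leq_mul.
  move: (2 ^ l * n) (t n * n) (T n).+1 (m n + T n).+1 => u v w1 w2 le_uv.
  have := leq_mul (leqnn C) le_uv; rewrite !mulnDr; nia.
- apply: leq_trans (size_distill_cnf size_f0 size_ys) _.
  rewrite -/(Bd n) /B /Bd; have : 2 ^ l * n <= t n * n by apply: leq_mul.
  move: (2 ^ l * n) (t n * n) (T n).+1 (m n + T n).+1 => u v w1 w2 le_uv.
  have := leq_mul (leqnn C) le_uv; rewrite !mulnDr; lia.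
- exact: distill_cnf_nonempty.
move=> x; split.
  move=> /ys_cov[X [[j Xj] yX]].
  exact: (distill_cnf_complete MK' le_sm f0_sat Xj yX).
case=> c sat_c cx.
exact: (distill_cnf_sound ne_f fP K_equiv MK' le_sm f0_uniq ys_src sat_c cx).
Qed.

(** * A machine that evaluates formulas *)

Local Notation sym := (symbol void).
Local Notation bits := (map (fun b : bool => Some (inl b) : sym)).
Local Notation blanks j := (nseq j (None : sym)).

Definition estate : finType :=
  ((bool * option bool) + ((bool * option bool) + option (option bool)))%type.

(* [Copy] reads the doubled string: its first argument tells a marker from a
   payload bit, its second one is the state of the decoder of the inner pair. *)
Local Notation Copy o i := (inl (o, i) : estate).
Local Notation Eval flag c := (inr (inl (flag, c)) : estate).
Local Notation Wit := (inr (inr None) : estate).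
Local Notation Halt := (inr (inr (Some None)) : estate).
Local Notation Rewind b := (inr (inr (Some (Some b))) : estate).

(* Commands are pairs of bits: [true, d] tests whether the scanned variable is
   [d], [false, false] goes to the next variable, [false, true] ends a clause. *)
Definition eval_trans (q : estate) (a0 a1 a2 : sym) :
    estate * ((sym * move) * (sym * move) * (sym * move)) :=
  let keep a := (a, Stay) in
  let halt b := (Halt, ((Some (inl b), Stay), keep a1, keep a2)) in
  match q with
  | inl (false, i) =>
      match a0 with
      | Some (inl true) => (Copy true i, ((a0, MoveR), keep a1, keep a2))
      | Some (inl false) => (Wit, ((a0, MoveR), keep a1, keep a2))
      | _ => halt false
      end
  | inl (true, i) =>
      match i with
      | Some false =>
          (Copy false (if a0 == Some (inl true) then Some true else None),
           ((a0, MoveR), keep a1, keep a2))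
      | Some true => (Copy false (Some false), ((a0, MoveR), (a0, MoveR), keep a2))
      | None => (Copy false None, ((a0, MoveR), keep a1, (a0, MoveR)))
      end
  | inr (inr None) =>
      if a0 is Some (inl b) then (Wit, ((a0, MoveR), (a0, MoveR), keep a2))
      else (Rewind false, (keep a0, keep a1, (a2, MoveL)))
  | inr (inr (Some (Some false))) =>
      (Rewind true, (keep a0, (a1, MoveL), keep a2))
  | inr (inr (Some (Some true))) =>
      if a1 is Some (inl _) then (Rewind true, (keep a0, (a1, MoveL), keep a2))
      else (Eval false None, (keep a0, (a1, MoveR), keep a2))
  | inr (inl (flag, None)) =>
      if a2 is Some (inl c) then
        (Eval flag (Some c), (keep a0, keep a1, (a2, MoveL)))
      else halt true
  | inr (inl (flag, Some c)) =>
      match c, a2 with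
      | true, Some (inl d) =>
          (Eval (flag || (a1 == Some (inl d))) None,
           (keep a0, keep a1, (a2, MoveL)))
      | false, Some (inl false) =>
          (Eval flag None, (keep a0, (a1, if a1 is None then Stay else MoveR),
                            (a2, MoveL)))
      | false, Some (inl true) =>
          if flag then (Rewind false, (keep a0, keep a1, (a2, MoveL)))
          else halt false
      | _, _ => halt true
      end
  | inr (inr (Some None)) => (q, (keep a0, keep a1, keep a2))
  end.

Definition three (A : Type) (x : A * A * A) (i : 'I_3) : A :=
  match val i with 0 => x.1.1 | 1 => x.1.2 | _ => x.2 end.

Definition evaluator : machine :=
  @Machine 2 void estate (Copy false (Some false)) (fun q => q == Halt)
    (fun q a => let r := eval_trans q (a ord0) (a (inord 1)) (a (inord 2)) in
                (r.1, three r.2)).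

Definition conf (q : estate) (t0 t1 t2 : tape void) : config evaluator :=
  (q, [ffun i => three (t0, t1, t2) i]).

Lemma step_conf q t0 t1 t2 :
  step (conf q t0 t1 t2) =
  if q == Halt then conf q t0 t1 t2 else
  let r := eval_trans q (tcur t0) (tcur t1) (tcur t2) in
  conf r.1 (tmove r.2.1.1.2 (twrite r.2.1.1.1 t0))
           (tmove r.2.1.2.2 (twrite r.2.1.2.1 t1))
           (tmove r.2.2.2 (twrite r.2.2.1 t2)).
Proof.
rewrite /step /=; case: ifP => // _; rewrite !ffunE /three /= !inordK //=.
congr (_, _); apply/ffunP => i; rewrite !ffunE /three.
by case: i => [[|[|k]] lt_k].
Qed.

Definition in_tape (L : seq sym) (x : seq bool) : tape void :=
  Tape L (head None (bits x)) (behead (bits x)).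

Definition out_tape (r : seq bool) : tape void := Tape (bits r) None [::].

(** The commands are copied rightwards but read leftwards; hence the advice stores them in
    reverse. *)
Definition cmd_tape (cs : seq bool) (R : seq sym) : tape void :=
  Tape (behead (bits cs)) (head None (bits cs)) R.

(** Visited blanks remain listed on a tape, and tapes that differ in listed blanks are different
    terms; [i] and [j] count them on both sides. *)
Definition scan_tape (l r : seq bool) (i j : nat) : tape void :=
  Tape (bits r ++ blanks i) (head None (bits l ++ blanks j))
       (behead (bits l ++ blanks j)).

Definition rewind_tape (l r : seq bool) (i j : nat) : tape void :=
  Tape (behead (bits r ++ blanks i)) (head None (bits r ++ blanks i))
       (bits l ++ blanks j).

Fixpoint decode (i : option bool) (s : seq bool) (l : seq bool * seq bool) :=
  if s is b :: s' then
    match i with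
    | Some false => decode (if b then Some true else None) s' l
    | Some true => decode (Some false) s' (b :: l.1, l.2)
    | None => decode None s' (l.1, b :: l.2)
    end
  else l.

Lemma copy_phase i s w L l : exists L',
  iter (size s).*2.+1 (@step evaluator)
    (conf (Copy false i) (in_tape L (enc_pair (s, w))) (out_tape l.1) (out_tape l.2))
  = conf Wit (in_tape L' w) (out_tape (decode i s l).1) (out_tape (decode i s l).2).
Proof.
elim: s i L l => [|b s IHs] i L l; rewrite iterSr step_conf.
  by exists (Some (inl false) :: L).
set L' := Some (inl b) :: Some (inl true) :: L.
rewrite [size _]/= doubleS iterSr /= step_conf.
case: i => [[]|].
- by have [L'' e] := IHs (Some false) L' (b :: l.1, l.2); exists L''; exact: e.
- have [L'' e] := IHs (if b then Some true else None) L' l; exists L''.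
  by case: b @L' e => L' e; exact: e.
- by have [L'' e] := IHs None L' (l.1, b :: l.2); exists L''; exact: e.
Qed.

Lemma witness_phase w L l cs : exists L',
  iter (size w).+1 (@step evaluator)
    (conf Wit (in_tape L w) (out_tape l) (out_tape cs))
  = conf (Rewind false) (in_tape L' [::]) (scan_tape [::] (catrev w l) 0 0)
         (cmd_tape cs [:: None]).
Proof.
elim: w L l => [|b w IHw] L l; rewrite iterSr step_conf.
  by exists L; rewrite /= /scan_tape cats0.
by have [L' e] := IHw (Some (inl b) :: L) (b :: l); exists L'; exact: e.
Qed.

Lemma cons_blank l j : exists j',
  head None (bits l ++ blanks j) :: behead (bits l ++ blanks j)
  = bits l ++ blanks j'.
Proof.
by case: l => [|b l]; [case: j => [|j]; [exists 1|exists j.+1]|exists j].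
Qed.

Lemma rewind_loop l r i j t0 t2 : exists i',
  iter (size r).+1 (@step evaluator)
    (conf (Rewind true) t0 (rewind_tape l r i j) t2)
  = conf (Eval false None) t0 (scan_tape (catrev r l) [::] i' j) t2.
Proof.
case: t0 t2 => [l0 c0 r0] [l2 c2 r2].
elim: r l => [|b r IHr] l; rewrite iterSr step_conf /=.
  have [i' eqi] := cons_blank [::] i; exists i'.
  have -> : head None (blanks i) = None by case: i {eqi}.
  rewrite /conf /scan_tape /= -[blanks i']eqi.
  by have -> : head None (blanks i) = None by case: i {eqi}.
by have [i' e] := IHr (b :: l); exists i'; exact: e.
Qed.

Lemma rewind_phase l r i j t0 t2 : exists i' j',
  iter (size r).+2 (@step evaluator)
    (conf (Rewind false) t0 (scan_tape l r i j) t2)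
  = conf (Eval false None) t0 (scan_tape (catrev r l) [::] i' j') t2.
Proof.
rewrite iterSr step_conf.
have [j' eqj] := cons_blank l j.
have [i' eqi] := rewind_loop l r i j' t0 t2; exists i', j'; rewrite -eqi.
by case: t0 t2 {eqi} => [l0 c0 r0] [l2 c2 r2]; rewrite /= eqj.
Qed.

(** [l] is the rest of the assignment [vs] from the scanned variable on, and [flag] records whether
    the current clause is already true. Running out of commands means acceptance. *)
Fixpoint run_cmds (vs l : seq bool) (flag : bool) (cs : seq bool) : bool :=
  match cs with
  | c :: d :: cs' =>
      if c then run_cmds vs l (flag || (ohead l == Some d)) cs'
      else if d then flag && run_cmds vs vs false cs'
      else run_cmds vs (behead l) flag cs'
  | _ => true
  end.

Definition halts_with (c : config evaluator) (b : bool) (t : nat) : Prop :=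
  exists2 k, k <= t &
    let c' := iter k (@step evaluator) c in halting c'.1 /\ output c' = [:: b].

Lemma halts_with_iter k c b t :
  halts_with (iter k (@step evaluator) c) b t -> halts_with c b (k + t).
Proof.
by case=> k' le_k'; rewrite -iterD addnC => h; exists (k + k'); rewrite // leq_add2l.
Qed.

Lemma halts_withW c b t t' : t <= t' -> halts_with c b t -> halts_with c b t'.
Proof. by move=> le_t [k le_k h]; exists k; rewrite // (leq_trans le_k). Qed.

Lemma halts_with_Halt L b t1 t2 t :
  halts_with (conf Halt (Tape L (Some (inl b)) [::]) t1 t2) b t.
Proof. by exists 0; rewrite // /output ffunE. Qed.

(** A command takes two steps, and the end of a clause at most [size vs + 2] more for rewinding; the
    bound charges this to the two bits of the command. *)
Lemma eval_phase cs vs l r i j flag L R : vs = catrev r l ->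
  halts_with (conf (Eval flag None) (in_tape L [::]) (scan_tape l r i j)
                   (cmd_tape cs R))
             (run_cmds vs l flag cs) (size cs * (size vs + 3) + 1).
Proof.
have [n] := ubnP (size cs); elim: n cs l r i j flag R => // n IHn.
move=> [|c [|d cs]] l r i j flag R lt_n vsE.
- apply: (@halts_with_iter 1); rewrite /= step_conf; exact: halts_with_Halt.
- apply: halts_withW (@halts_with_iter 2 _ _ 0 _); first by rewrite /=; lia.
  by rewrite /= !step_conf; case: c {lt_n}; apply: halts_with_Halt.
have {}IHn := IHn cs; have {lt_n} lt_n : size cs < n by move: lt_n => /=; lia.
have curE b : (tcur (scan_tape l r i j) == Some (inl b)) = (ohead l == Some b).
  by case: l {vsE} => [|b' l] /=; [case: j|case: b' b => [] []].
case: c.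
  have := IHn l r i j (flag || (ohead l == Some d))
    (Some (inl d) :: Some (inl true) :: R) lt_n vsE.
  rewrite -{1}curE => h; apply: halts_withW (@halts_with_iter 2 _ _ _ _).
    2: by rewrite /= !step_conf; exact: h.
  by rewrite /=; lia.
case: d.
  case: flag; last first.
    apply: halts_withW (@halts_with_iter 2 _ _ 0 _); first by rewrite /=; lia.
    by rewrite /= !step_conf; apply: halts_with_Halt.
  have [i' [j' eqr]] := rewind_phase l r i j (in_tape L [::])
    (cmd_tape cs (Some (inl true) :: Some (inl false) :: R)).
  have := IHn vs [::] i' j' false (Some (inl true) :: Some (inl false) :: R) lt_n erefl.
  rewrite {1}vsE -eqr => /halts_with_iter h.
  apply: halts_withW (@halts_with_iter 2 _ _ _ _).
    2: by rewrite /= !step_conf; exact: h.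
  have : size r <= size vs by rewrite vsE catrevE size_cat size_rev leq_addr.
  by rewrite /=; lia.
(* On a blank the head stays in place, which matches [behead [::] = [::]]. *)
case: l vsE curE => [|b l] vsE curE.
  have h := IHn [::] r i j flag (Some (inl false) :: Some (inl false) :: R) lt_n vsE.
  apply: halts_withW (@halts_with_iter 2 _ _ _ _).
    2: have hd : head None (blanks j) = None by case: (j).
    2: by move: h; rewrite /= !step_conf /scan_tape /= hd; apply.
  by rewrite /=; lia.
have h := IHn l (b :: r) i j flag (Some (inl false) :: Some (inl false) :: R) lt_n vsE.
apply: halts_withW (@halts_with_iter 2 _ _ _ _).
  2: by rewrite /= !step_conf; exact: h.
by rewrite /=; lia.
Qed.

Definition verify (sw : seq bool * seq bool) : bool :=
  let l := decode (Some false) sw.1 ([::], [::]) in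
  let vs := rev (catrev sw.2 l.1) in run_cmds vs vs false l.2.

Lemma size_decode i s l :
  size (decode i s l).1 + size (decode i s l).2 <= size s + size l.1 + size l.2.
Proof.
elim: s i l => [|b s IHs] [[]|] l //=; apply: leq_trans (IHs _ _) _ => /=; lia.
Qed.

Lemma init_evaluator x :
  init evaluator x
  = conf (Copy false (Some false)) (in_tape [::] x) (out_tape [::]) (out_tape [::]).
Proof.
by congr (_, _); apply/ffunP => -[[|[|k]] lt_k]; rewrite !ffunE.
Qed.

Lemma halts_with_verify s w :
  halts_with (init evaluator (enc_pair (s, w))) (verify (s, w))
    (10 * (size (enc_pair (s, w))) * (size (enc_pair (s, w)))).
Proof.
rewrite init_evaluator /verify.
have := size_decode (Some false) s ([::], [::]).
have [L eqc] := copy_phase (Some false) s w [::] ([::], [::]).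
move: eqc; case: (decode _ _ _) => [l cs] /= eqc size_l.
have [L' eqw] := witness_phase w L l cs.
have [i [j eqr]] := rewind_phase [::] (catrev w l) 0 0 (in_tape L' [::])
                      (cmd_tape cs [:: None]).
have h := @eval_phase cs (rev (catrev w l)) (rev (catrev w l)) [::] i j false L'
            [:: None] erefl.
rewrite -{1}[rev (catrev w l)]/(catrev _ _) -eqr -eqw -eqc in h.
do 2 move/halts_with_iter in h.
apply: halts_withW (@halts_with_iter (size s).*2.+1 _ _ _ h).
rewrite size_enc_pair size_rev catrevE size_cat size_rev.
have : 0 < (size s).*2.+1 + size w by [].
move: (size s) (size w) (size l) (size cs) size_l => s' w' l' c' size_l _.
by rewrite -!muln2; nia.
Qed.

Lemma polytime_verify : polytime enc_pair enc_bool verify.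
Proof.
have [p le_p] : pbounded (fun n => 10 * n * n).
  exact: pboundedM (pboundedM (pbounded_cst 10) pbounded_id) pbounded_id.
exists evaluator, p => -[s w].
have [k le_k [hk ok]] := halts_with_verify s w.
by apply: outputs_withinW (conj hk ok); apply: leq_trans (le_p _).
Qed.

(** * The advice *)

Definition var_cmds (c : seq (nat * bool)) (i : nat) : seq bool :=
  (if (i, true) \in c then [:: true; true] else [::]) ++
  (if (i, false) \in c then [:: true; false] else [::]) ++ [:: false; false].

Definition clause_cmds (v : nat) (c : seq (nat * bool)) : seq bool :=
  flatten [seq var_cmds c i | i <- iota 0 v] ++ [:: false; true].

(* A literal on a variable beyond the end of the assignment is false. *)
Definition sat_prefix (vs : seq bool) (c : seq (nat * bool)) : bool :=
  has (fun l => onth vs l.1 == Some l.2) c.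

Lemma ohead_drop (T : Type) (s : seq T) i : ohead (drop i s) = onth s i.
Proof. by elim: s i => [|x s IHs] [|i] //=. Qed.

Lemma run_var_cmds vs c i k flag cs :
  run_cmds vs (drop i vs) flag
    (flatten [seq var_cmds c j | j <- iota i k] ++ cs)
  = run_cmds vs (drop (i + k) vs)
      (flag || has (fun l => (i <= l.1 < i + k) && (onth vs l.1 == Some l.2)) c) cs.
Proof.
elim: k i flag => [|k IHk] i flag /=.
  rewrite addn0 (eq_has (a2 := pred0)) ?has_pred0 ?orbF // => l /=; lia.
set h := has _ _.
have -> : h = has (fun l => (l.1 == i) && (onth vs i == Some l.2)) c
           || has (fun l => (i.+1 <= l.1 < i.+1 + k) && (onth vs l.1 == Some l.2)) c.
  rewrite /h -has_predU; apply: eq_has => l /=; rewrite addSnnS.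
  have [->|ne] := eqVneq l.1 i; first by rewrite ltnn; lia.
  by have -> : (i <= l.1) = (i < l.1) by lia.
rewrite orbA -addSnnS -IHk.
have -> : has (fun l => (l.1 == i) && (onth vs i == Some l.2)) c
  = ((i, true) \in c) && (onth vs i == Some true)
    || ((i, false) \in c) && (onth vs i == Some false).
  apply/hasP/orP => [[[j b] jc /= /andP[/eqP eq_j vb]]|].
    by rewrite eq_j in jc; case: b jc vb => jc vb; [left|right]; apply/andP.
  by case=> /andP[ic vi]; [exists (i, true)|exists (i, false)]; rewrite //= eqxx.
rewrite /var_cmds; case: ((i, true) \in c); case: ((i, false) \in c);
  by rewrite /= ?ohead_drop -?drop1 ?drop_drop ?add1n ?orbA ?orbF.
Qed.

Lemma run_clauses vs v (f : cnf nat) k :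
    (forall c l, c \in f -> l \in c -> l.1 < v) ->
  run_cmds vs vs false (flatten [seq clause_cmds v c | c <- f] ++ nseq k.*2 false)
  = all (sat_prefix vs) f.
Proof.
elim: f => [|c f IHf] lt_v /=.
  have pad l : run_cmds vs l false (nseq k.*2 false) = true.
    by elim: k l => //= k IHk l; rewrite IHk.
  exact: pad.
rewrite /clause_cmds -!catA -{2}[vs]drop0 run_var_cmds /= add0n IHf; last first.
  by move=> c' l c'f; apply: lt_v; rewrite inE c'f orbT.
congr (_ && _); apply: eq_in_has => l lc /=.
by rewrite (lt_v c l) ?mem_head.
Qed.

Lemma decode_enc_pair x a l :
  decode (Some false) (enc_pair (x, a)) l = (catrev x l.1, catrev a l.2).
Proof.
elim: x l => [|b x IHx] l; last exact: IHx.
rewrite [enc_pair _]/=; elim: a l => [|b a IHa] l /=; first by case: l.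
exact: IHa.
Qed.

Lemma verify_enc_pair x cs w :
  verify (enc_pair (x, rev cs), w) = run_cmds (x ++ w) (x ++ w) false cs.
Proof.
rewrite /verify decode_enc_pair /= !catrevE cats0 cats0 revK.
by rewrite -rev_cat revK.
Qed.

Definition var_index (n : nat) (Z : finType) (y : 'I_n + Z) : nat :=
  match y with inl b => b | inr z => n + enum_rank z end.

(** The advice is the formula of the non-members, compiled into commands; an assignment to its
    variables [Z] is the witness. *)
Theorem with_poly_advice_coNP (L : language) :
  poly_cnf (fun x => ~ L x) -> with_poly_advice coNP L.
Proof.
move=> [B pB Lb].
pose good n (a : seq bool) := size a <= B n * (6 * (n + B n) + 2) + 2 * B n /\
  forall x : n.-tuple bool, ~ L x <->
    exists w, size w <= size (enc_pair (val x, a)) /\ verify (enc_pair (val x, a), w).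
have /choice[advice adviceP] : forall n, exists a, good n a.
  move=> n; have [Z [f [card_Z size_f ne_f fP]]] := Lb n.
  set v := n + #|Z|.
  pose f' : cnf nat := map_cnf (@var_index n Z) f.
  (* The final commands only advance the variable; they make the verified string long enough for a
     witness of length [#|Z|] to be no longer than it. *)
  pose cs := flatten [seq clause_cmds v c | c <- f'] ++ nseq #|Z|.*2 false.
  have lt_v c l : c \in f' -> l \in c -> l.1 < v.
    case/mapP=> c' _ -> /mapP[[y b] _ ->] /=; rewrite /v.
    case: y => [i|z] /=; first by apply: leq_trans (ltn_ord i) (leq_addr _ _).
    by rewrite ltn_add2l ltn_ord.
  exists (rev cs); split.
    rewrite size_rev size_cat size_nseq -muln2 mulnC leq_add ?leq_mul //.
    have size_cl c : size (clause_cmds v c) <= 6 * (n + B n) + 2.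
      rewrite size_cat leq_add2r; apply: leq_trans (_ : 6 * v <= _); last first.
        by rewrite leq_mul2l leq_add2l card_Z orbT.
      rewrite -{2}(size_iota 0 v); elim: (iota 0 v) => //= i s IHs.
      rewrite size_cat mulnS leq_add // /var_cmds !size_cat.
      by case: ifP => _; case: ifP.
    apply: leq_trans (_ : size f * (6 * (n + B n) + 2) <= _); last first.
      by rewrite leq_mul.
    have -> : size f = size f' by rewrite size_map.
    by elim: f' {lt_v cs} => //= c g IHg; rewrite size_cat mulSn leq_add.
  move=> x; rewrite fP; split.
    case=> a sat_a ax; pose w := [seq a (inr z) | z <- enum Z].
    exists w; rewrite verify_enc_pair run_clauses //; split.
      rewrite size_enc_pair size_map -cardE size_rev /cs size_cat size_nseq.
      apply: leq_trans _ (leq_addl _ _); rewrite -addnn addnA; exact: leq_addl.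
    have onthE y : onth (x ++ w) (var_index y) = Some (a y).
      rewrite (onth_if false) size_cat size_tuple size_map -cardE.
      case: y => [i|z] /=.
        rewrite ltn_addr // nth_cat size_tuple ltn_ord ax.
        by rewrite (tnth_nth false).
      rewrite ltn_add2l ltn_ord nth_cat size_tuple ltnNge leq_addr /= addKn.
      by rewrite (nth_map z) -?cardE ?ltn_ord // nth_enum_rank.
    apply/allP => _ /mapP[c cf ->]; move/allP/(_ c cf)/hasP: sat_a => [l lc al].
    apply/hasP; exists (var_index l.1, l.2).
      exact: (map_f (fun l => (var_index l.1, l.2))).
    by rewrite /= onthE; apply/eqP; congr Some; apply/eqP.
  case=> w [_]; rewrite verify_enc_pair run_clauses // => sat_w.
  (* [w] may be too short, but [sat_prefix] only counts literals at existing positions, so the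
     default [false] is never decisive. *)
  exists (fun y => nth false (x ++ w) (var_index y)) => [|b]; last first.
    by rewrite /= nth_cat size_tuple ltn_ord (tnth_nth false).
  rewrite -[X in sat X _]/(nth false (x ++ w) \o @var_index n Z) -sat_map.
  apply/allP => c /(allP sat_w)/hasP[l lc]; rewrite (onth_if false).
  by case: ifP => // _ /eqP[vl]; apply/hasP; exists l; rewrite // vl.
pose Q w s := size w <= size s /\ verify (s, w).
exists (fun s => ~ exists w, Q w s), advice.
have [p le_p] : pbounded (fun n => B n * (6 * (n + B n) + 2) + 2 * B n).
  apply: pboundedD; last exact: pboundedM (pbounded_cst 2) pB.
  apply: pboundedM (pB) _; apply: pboundedD _ (pbounded_cst 2).
  exact: pboundedM (pbounded_cst 6) (pboundedD pbounded_id pB).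
exists p; split.
- exists verify, ('X)%R; split.
    exact: polytime_verify.
  by move=> s; rewrite hornerX notK.
- by move=> n; have [le_a _] := adviceP n; apply: leq_trans (le_p n).
- move=> x; have [_ /(_ (in_tuple x)) advP] := adviceP (size x).
  rewrite -/(Q _ _) -advP /=; split=> [Lx nLx //|]; exact: contrapT.
Qed.

Theorem theorem3 :
  ~ NP_subset_coNP_poly ->
  ~ poly_kernel enc_instance IdentifyingCode vc_plus_k.
Proof.
move=> nsub ker; apply: nsub => L /NP_poly_cnf.
by move/(poly_cnf_compl ker)/with_poly_advice_coNP.
Qed.
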